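(* Let $\Omega\subset\mathbb{R}^d$ be a bounded convex open set, let $v_1,v_2,\ldots$ be a countable (finite or countably infinite) family of distinct vectors in $\mathbb{R}^d$, and let $m_1,m_2,\ldots$ be positive numbers, indexed by the same index set, such that $\sum_i m_i=\lambda(\Omega)$. Then there is a function $\varphi:\Omega\to\mathbb{R}$, unique up to adding a constant, that is locally affine a.e. and convex, and such that for each $i$, $\nabla\varphi=v_i$ on an open convex set $A_i\subset\Omega$ with $\lambda(A_i)=m_i$.
   Context: $\lambda$ denotes Lebesgue measure on $\mathbb{R}^d$. A function $\varphi:\Omega\to\mathbb{R}$ is called locally affine a.e. if, for Lebesgue-a.e. $x\in\Omega$, $\varphi$ is affine on some neighborhood of $x$. *)

(* Defs.v *)
From HB Require Import structures.
From mathcomp Require Import all_boot all_order all_algebra.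
From mathcomp Require Import all_classical all_reals all_analysis.

Set Implicit Arguments.
Unset Strict Implicit.
Unset Printing Implicit Defensive.

Import Order.TTheory GRing.Theory Num.Theory.
Import numFieldNormedType.Exports.

Local Open Scope classical_set_scope.
Local Open Scope ring_scope.

Definition measure_rV_display : measure_display -> measure_display.
Proof. exact. Qed.

(* Row vectors carry the product sigma-algebra, generated by the coordinate
   maps, like [n.-tuple T] in the library; for [R : realType] this is the Borel
   sigma-algebra of ['rV[R]_n]. *)
Section measurable_rV.
Context {d} {T : measurableType d}.
Variable n : nat.

Let coors : 'I_n -> 'rV[T]_n -> T := fun i x => x ord0 i.

Let rV_set0 : g_sigma_preimage coors set0.
Proof. exact: sigma_algebra0. Qed.

Let rV_setC A : g_sigma_preimage coors A -> g_sigma_preimage coors (~` A).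
Proof. exact: sigma_algebraC. Qed.

Let rV_bigcup (F : _^nat) : (forall i, g_sigma_preimage coors (F i)) ->
  g_sigma_preimage coors (\bigcup_i (F i)).
Proof. exact: sigma_algebra_bigcup. Qed.

HB.instance Definition _ := @isMeasurable.Build (measure_rV_display d)
  ('rV[T]_n) (g_sigma_preimage coors) rV_set0 rV_setC rV_bigcup.

End measurable_rV.

Section measurable_rV_fun.
Context d1 d2 (T1 : measurableType d1) (T2 : measurableType d2).

Lemma measurable_coord n (i : 'I_n) :
  measurable_fun [set: 'rV[T2]_n] (fun x : 'rV[T2]_n => x ord0 i).
Proof.
move=> _ Y mY; rewrite setTI; apply: sub_sigma_algebra => /=.
rewrite -bigcup_seq/=; exists i => /=; first by rewrite mem_index_enum.
by exists Y => //; rewrite setTI.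
Qed.

Lemma measurable_fun_rVP n (f : T1 -> 'rV[T2]_n) :
  (forall i, measurable_fun [set: T1] (fun x => f x ord0 i)) ->
  measurable_fun [set: T1] f.
Proof.
move=> mf _ A mA.
have : preimage_set_system [set: T1] f measurable (f @^-1` A).
  by exists A => //; rewrite setTI.
rewrite -[X in X _](g_sigma_preimage_comp
  (fun (i : 'I_n) (x : 'rV[T2]_n) => x ord0 i) f) setTI.
move: (f @^-1` A); apply: smallest_sub.
  exact: sigma_algebra_measurable.
move=> B; rewrite -bigcup_seq => -[i _ [C mC <-]]; exact: mf.
Qed.

End measurable_rV_fun.

Section lebesgue_rV.
Variable R : realType.

Definition rV_cons n (p : measurableTypeR R * 'rV[R]_n) : 'rV[R]_n.+1 :=
  \row_i oapp (fun j => p.2 ord0 j) p.1 (unlift ord0 i).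

Definition rV_uncons n (x : 'rV[R]_n.+1) : measurableTypeR R * 'rV[R]_n :=
  (x ord0 ord0, \row_j x ord0 (lift ord0 j)).

Lemma rV_consK n : cancel (@rV_cons n) (@rV_uncons n).
Proof.
move=> [a y]; rewrite /rV_uncons mxE unlift_none/=; congr pair.
by apply/rowP => j; rewrite !mxE liftK.
Qed.

Lemma rV_unconsK n : cancel (@rV_uncons n) (@rV_cons n).
Proof.
move=> x; apply/rowP => i; rewrite mxE.
by case: unliftP => [j ->|->] /=; rewrite ?mxE.
Qed.

Lemma measurable_rV_cons n : measurable_fun setT (@rV_cons n).
Proof.
apply: measurable_fun_rVP => i.
under eq_fun do rewrite mxE.
case: unliftP => [j _|_] /=; last first.
  by move=> mT A mA; exact: (@measurable_fst _ _ (measurableTypeR R)).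
apply: (@measurableT_comp _ _ _ _ _ _ (fun x : 'rV[R]_n => x ord0 j)) => //.
exact: measurable_coord.
Qed.

Lemma measurable_rV_uncons n : measurable_fun setT (@rV_uncons n).
Proof.
apply/measurable_fun_pairP; split.
  by move=> mT A mA; exact: (@measurable_coord _ R).
apply: measurable_fun_rVP => i /=.
under eq_fun do rewrite mxE.
exact: measurable_coord.
Qed.

Section lebesgue_rVS.
Variables (n : nat) (mu : {sigma_finite_measure set 'rV[R]_n -> \bar R}).

Definition lebesgue_rVS : set 'rV[R]_n.+1 -> \bar R :=
  pushforward (@lebesgue_measure R \x mu)%E (@rV_cons n).

Let nu : {measure set 'rV[R]_n.+1 -> \bar R} :=
  measure_function_pushforward__canonical__measure_function_Measure
    ((@lebesgue_measure R \x mu)%E : {measure set _ -> \bar R})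
    (@measurable_rV_cons n).

HB.instance Definition _ := isMeasure.Build _ _ _ lebesgue_rVS
  (measure0 nu) (measure_ge0 nu) (@measure_semi_sigma_additive _ _ _ nu).

Let lebesgue_rVS_sigma_finite : sigma_finite setT lebesgue_rVS.
Proof.
have /sigma_finiteP[F [TF ndF Foo]] := sigma_finiteT (@lebesgue_measure R).
have /sigma_finiteP[G [TG ndG Goo]] := sigma_finiteT mu.
exists (fun k => @rV_uncons n @^-1` (F k `*` G k)).
  rewrite -preimage_bigcup (_ : \bigcup_k _ = setT) ?preimage_setT//.
  apply/seteqP; split=> // -[x y] _.
  have [i _ Fx] : (\bigcup_i F i) x by rewrite -TF.
  have [j _ Gy] : (\bigcup_i G i) y by rewrite -TG.
  exists (maxn i j) => //; split => /=.
    by move: x Fx; exact/subsetPset/ndF/leq_maxl.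
  by move: y Gy; exact/subsetPset/ndG/leq_maxr.
move=> k; have [mF Fk] := Foo k; have [mG Gk] := Goo k; split.
  rewrite -[X in measurable X]setTI; apply: measurable_rV_uncons => //.
  exact: measurableX.
rewrite /lebesgue_rVS /pushforward -comp_preimage.
rewrite (_ : _ \o _ = id) ?preimage_id; last first.
  by apply/funext => p /=; rewrite rV_consK.
by rewrite product_measure1E// lte_mul_pinfty// ge0_fin_numE.
Qed.

HB.instance Definition _ := Measure_isSigmaFinite.Build _ _ _ lebesgue_rVS
  lebesgue_rVS_sigma_finite.

End lebesgue_rVS.

Fixpoint lebesgue_rV n : {sigma_finite_measure set 'rV[R]_n -> \bar R} :=
  if n is k.+1 then lebesgue_rVS (lebesgue_rV k) else \d_(0 : 'rV[R]_0).

(* Together with sigma-finiteness, this value on boxes characterizes Lebesgue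
   measure. *)
Lemma lebesgue_rV_box n (a b : 'rV[R]_n) : (forall i, a ord0 i <= b ord0 i) ->
  lebesgue_rV n [set x | forall i, a ord0 i < x ord0 i < b ord0 i] =
  (\prod_(i < n) (b ord0 i - a ord0 i))%:E.
Proof.
elim: n => [|n IH] in a b * => ab /=.
  by rewrite big_ord0 diracE mem_set// => -[].
rewrite /lebesgue_rVS /pushforward.
have -> : @rV_cons n @^-1` [set x | forall i, a ord0 i < x ord0 i < b ord0 i] =
    [set` `]a ord0 ord0, b ord0 ord0[] `*` [set y : 'rV[R]_n | forall i : 'I_n,
      (\row_j a ord0 (lift ord0 j)) ord0 i < y ord0 i <
      (\row_j b ord0 (lift ord0 j)) ord0 i].
  apply/seteqP; split=> [[t y]/= ty|[t y]/= [+ ty] i].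
    split=> [|i]; first by have := ty ord0; rewrite mxE unlift_none/= in_itv.
    by have := ty (lift ord0 i); rewrite !mxE liftK.
  rewrite in_itv/= mxE => tab; case: unliftP => [j ->|->]//=.
  by have := ty j; rewrite !mxE.
rewrite product_measure1E//=.
- rewrite IH; last by move=> i; rewrite !mxE.
  rewrite lebesgue_measure_itv/= lte_fin big_ord_recl; case: ltP => [_|ba].
    by rewrite -EFinB -EFinM; congr (_ * _)%:E; apply: eq_bigr => i _; rewrite !mxE.
  rewrite mul0e; have -> : b ord0 ord0 = a ord0 ord0 by apply/eqP; rewrite eq_le ba ab.
  by rewrite subrr mul0r.
- rewrite [X in measurable X](_ : _ = \bigcap_(i in [set: 'I_n])
    ((fun x : 'rV[R]_n => x ord0 i) @^-1`
     [set` `](\row_j a ord0 (lift ord0 j)) ord0 i, (\row_j b ord0 (lift ord0 j)) ord0 i[])).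
    apply: fin_bigcap_measurable => // i _.
    rewrite -[X in measurable X]setTI; apply: measurable_coord => //.
  apply/seteqP; split=> x /= xab i; first by move=> _ /=; rewrite in_itv/=.
  by have := xab i I; rewrite /= in_itv.
Qed.

End lebesgue_rV.

Section affine_gradient.
Context {R : realType} {d : nat}.
Implicit Types (phi : 'rV[R]_d -> R^o) (Omega : set 'rV[R]_d).

Definition affine_near phi (x : 'rV[R]_d) :=
  exists (l : {linear 'rV[R]_d -> R^o}) (c : R),
    \forall y \near x, phi y = l y + c.

Definition locally_affine_ae Omega phi :=
  {ae lebesgue_rV R d, forall x, Omega x -> affine_near phi x}.

Definition gradient phi (x : 'rV[R]_d) : 'rV[R]_d :=
  \row_(i < d) 'D_(delta_mx ord0 i) phi x.

(* Outside points of differentiability ['D_] takes junk values, hence the first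
   conjunct. *)
Definition has_gradient phi (x w : 'rV[R]_d) :=
  differentiable phi x /\ gradient phi x = w.

(* A function on the open set [Omega] is represented by a total function whose
   values outside [Omega] are irrelevant. *)
Definition convex_with_gradients Omega (I : Type) (v : I -> 'rV[R]_d)
    (m : I -> R) phi :=
  [/\ locally_affine_ae Omega phi, convex_function Omega phi &
      forall i, exists A : set 'rV[R]_d,
        [/\ open A, convex_set A, A `<=` Omega,
            lebesgue_rV R d A = (m i)%:E &
            forall x, A x -> has_gradient phi x (v i)]].

End affine_gradient.

(* Main.v *)
(* For heights [h : I -> R] let [cell h i] be the part of [Omega] where
   [dot (v i) + h i] is maximal among the functions [dot (v j) + h j].

   Existence is a Perron argument. Fix an index [i0]. Call [h] admissible if
   [h i0 = 0], if only finitely many functions are not hidden below the [i0]-th one,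
   and if [cell h i] has volume at most [m i] for all [i <> i0]. Then the [i0]-th
   cell has volume at least [m i0], which bounds [h]; and admissible heights are
   closed under maxima because raising the other heights shrinks a cell. At the
   supremum [hsup] of all admissible heights each cell has volume at least [m i],
   as otherwise some height could be raised further. Cells overlap in hyperplanes,
   so summing volumes gives equality. Convex sets have negligible boundary, so the
   interiors of the cells are as required.

   Uniqueness: let [A i], [B k] be the cells of two solutions [phi], [psi], and
   [offset i] the difference of their heights. If [A i] meets [B k] then
   [offset i <= offset k]; comparing the volumes of the unions of the cells with
   offset above a given value turns this into an equality. Hence [phi] and [psi]
   have a common subgradient at almost every point. Along a subdivided segment of
   such points, [psi - phi] changes by at most the step length times the total
   change of subgradient, hence not at all. *)
Require Import Defs.
From HB Require Import structures.
From mathcomp Require Import all_boot all_order all_algebra.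
From mathcomp Require Import all_classical all_reals all_analysis.
From mathcomp Require Import measurable_realfun ring lra.

Import Order.TTheory GRing.Theory Num.Theory.
Import numFieldNormedType.Exports.

Local Open Scope classical_set_scope.
Local Open Scope ring_scope.

(** * Lebesgue measure on row vectors *)

Section euclidean_measure.
Context {R : realType} {d : nat}.
Implicit Types (A E : set 'rV[R]_d) (a b x y : 'rV[R]_d).

Definition box a b : set 'rV[R]_d :=
  [set x | forall i, a ord0 i < x ord0 i < b ord0 i].

Lemma measurable_box a b : measurable (box a b).
Proof.
rewrite [X in measurable X](_ : _ = \bigcap_(i in [set: 'I_d])
    ((fun x : 'rV[R]_d => x ord0 i) @^-1` `]a ord0 i, b ord0 i[%classic)).
  apply: fin_bigcap_measurable => // i _.
  by rewrite -[X in measurable X]setTI; exact: measurable_coord.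
apply/seteqP; split=> x /= xab i; first by move=> _ /=; rewrite in_itv/=.
by have := xab i I; rewrite /= in_itv.
Qed.

Lemma lebesgue_rV_cube a (r : R) : 0 <= r ->
  lebesgue_rV R d (box a (\row_i (a ord0 i + r))) = (r ^+ d)%:E.
Proof.
move=> r0; rewrite lebesgue_rV_box; last by move=> i; rewrite !mxE lerDl.
under eq_bigr do rewrite mxE addrAC subrr add0r.
by rewrite prodr_const card_ord.
Qed.

(** The norm on row vectors is the maximum norm, so balls are cubes. *)
Lemma ball_rVE x (e : R) : 0 < e ->
  ball x e = box (\row_i (x ord0 i - e)) (\row_i (x ord0 i + e)).
Proof.
move=> e0; apply/seteqP; split=> y /=.
  move=> [_ xy] i; rewrite !mxE; have := xy ord0 i.
  by rewrite -ball_normE/= ltr_distlC.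
move=> xy; split=> // i j; rewrite (ord1 i); have := xy j.
by rewrite !mxE -ball_normE/= ltr_distlC.
Qed.

(** An open set is the union of the boxes with rational corners that it contains, and there are
    countably many of these. *)
Lemma open_measurable_rV A : open A -> measurable A.
Proof.
move=> oA.
pose Q (q : 'rV[rat]_d * 'rV[rat]_d) : set 'rV[R]_d :=
  let B := box (map_mx ratr q.1) (map_mx ratr q.2) in
  if `[< B `<=` A >] then B else set0.
rewrite (_ : A = \bigcup_q Q q); last first.
  apply/seteqP; split=> [x Ax|x [q _]]; last first.
    by rewrite /Q; case: asboolP => // BA /BA.
  have /nbhs_ballP[e/= e0 xeA] : nbhs x A by exact: open_nbhs_nbhs.
  have exq (u v : R) : u < v -> exists q : rat, u < ratr q < v.
    by move=> uv; have [q] := rat_in_itvoo uv; rewrite in_itv/=; exists q.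
  have [p hp] : exists p : 'rV[rat]_d, forall i, x ord0 i - e < ratr (p ord0 i) < x ord0 i.
    have /choice[f hf] : forall i, exists q : rat, x ord0 i - e < ratr q < x ord0 i.
      by move=> i; apply: exq; lra.
    by exists (\row_i f i) => i; rewrite mxE.
  have [q hq] : exists q : 'rV[rat]_d, forall i, x ord0 i < ratr (q ord0 i) < x ord0 i + e.
    have /choice[f hf] : forall i, exists q : rat, x ord0 i < ratr q < x ord0 i + e.
      by move=> i; apply: exq; lra.
    by exists (\row_i f i) => i; rewrite mxE.
  exists (p, q) => //; rewrite /Q; case: asboolP => [_|].
    by move=> i /=; rewrite !mxE; have := hp i; have := hq i; lra.
  case=> y py; apply: xeA; rewrite ball_rVE// => i; have := py i.
  by rewrite /= !mxE; have := hp i; have := hq i; lra.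
apply: countable_bigcupT_measurable => [|q]; first exact: countableP.
by rewrite /Q; case: asboolP => // _; exact: measurable_box.
Qed.

Lemma open_lebesgue_rV_gt0 A x : open A -> A x -> (0 < lebesgue_rV R d A)%E.
Proof.
move=> oA Ax; have /nbhs_ballP[e/= e0 xeA] : nbhs x A by exact: open_nbhs_nbhs.
apply: (@lt_le_trans _ _ (lebesgue_rV R d (ball x e))); last first.
  apply: le_measure => //; rewrite inE; last exact: open_measurable_rV.
  by rewrite ball_rVE//; exact: measurable_box.
rewrite ball_rVE// lebesgue_rV_box; last by move=> i; rewrite !mxE; lra.
by rewrite lte_fin prodr_gt0// => i _; rewrite !mxE; lra.
Qed.

Lemma bounded_rVP A : bounded_set A ->
  exists2 r : R, 0 < r & forall x, A x -> forall i, `|x ord0 i| < r.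
Proof.
move=> /pinfty_ex_gt0[M M0 AM]; exists (M + 1); first by lra.
move=> x Ax i; apply: (@le_lt_trans _ _ M); last by lra.
apply: le_trans (AM x Ax); rewrite /Num.norm/= mx_normrE.
exact: (le_bigmax _ (fun ij : 'I_1 * 'I_d => `|x ij.1 ij.2|) (ord0, i)).
Qed.

Lemma bounded_lebesgue_rV A : bounded_set A -> measurable A ->
  (lebesgue_rV R d A < +oo)%E.
Proof.
move=> /bounded_rVP[r r0 Ar] mA.
apply: (@le_lt_trans _ _ (lebesgue_rV R d (box (\row_i (- r)) (\row_i r)))).
  apply: le_measure; rewrite ?inE//; first exact: measurable_box.
  by move=> x /Ar xr i; rewrite !mxE -ltr_norml.
by rewrite lebesgue_rV_box ?ltry// => i; rewrite !mxE; lra.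
Qed.

End euclidean_measure.

(** * Lebesgue measure under translation and scaling *)

Section affine_change_of_variable.
Context {R : realType}.
Implicit Types s : R.

Lemma measurable_affine (a s : R) :
  measurable_fun [set: measurableTypeR R]
    ((fun t => a + s * t) : _ -> measurableTypeR R).
Proof. by apply: measurable_funD => //; exact: measurable_funM. Qed.

(** Rescaled by [|s|], the pushforward agrees with Lebesgue measure on half-open intervals, which
    determine it. *)
Lemma lebesgue_measure_affine (a s : R) (A : set R) : s != 0 -> measurable A ->
  lebesgue_measure ((fun t => a + s * t) @^-1` A) =
  (`|s|^-1%:E * lebesgue_measure A)%E.
Proof.
move=> s0 mA; have s1 : 0 < `|s| by rewrite normr_gt0.
pose mf := @measurable_affine a s.
pose push : {measure set (measurableTypeR R) -> \bar R} :=
  measure_function_pushforward__canonical__measure_function_Measure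
    (@lebesgue_measure R : {measure set _ -> \bar R}) mf.
pose k : {nonneg R} := NngNum (normr_ge0 s).
have H (B : set R) : measurable B -> lebesgue_measure B = (`|s|%:E * push B)%E.
  apply: (@lebesgue_measure_unique R (mscale k push)) => _ [[u v]] _ <- /=.
  rewrite /mscale/= /pushforward.
  have [s_lt0|s_gt0|] := ltgtP s 0; last by move/eqP; rewrite (negbTE s0).
  - have -> : (fun t => a + s * t) @^-1` `]u, v]%classic =
        `[(v - a) / s, (u - a) / s[%classic.
      apply/seteqP; split=> t /=; rewrite !in_itv/=.
        by rewrite ler_ndivrMr// ltr_ndivlMr// => /andP[? ?]; apply/andP; split; lra.
      by rewrite ler_ndivrMr// ltr_ndivlMr// => /andP[? ?]; apply/andP; split; lra.
    rewrite !lebesgue_measure_itv/= !lte_fin ltr_ndivrMr// divfK ?lt_eqF//.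
    rewrite ltrD2r; case: ifP => // _; last by rewrite mule0.
    rewrite -!EFinD -EFinM ltr0_norm//; congr EFin; field; lra.
  - have -> : (fun t => a + s * t) @^-1` `]u, v]%classic =
        `](u - a) / s, (v - a) / s]%classic.
      apply/seteqP; split=> t /=; rewrite !in_itv/=.
        by rewrite ler_pdivlMr// ltr_pdivrMr// => /andP[? ?]; apply/andP; split; lra.
      by rewrite ler_pdivlMr// ltr_pdivrMr// => /andP[? ?]; apply/andP; split; lra.
    rewrite !lebesgue_measure_itv/= !lte_fin ltr_pdivlMr// divfK ?gt_eqF//.
    rewrite ltrD2r; case: ifP => // _; last by rewrite mule0.
    rewrite -!EFinD -EFinM gtr0_norm//; congr EFin; field; lra.
by rewrite (H A mA) muleA -EFinM mulVf ?gt_eqF// mul1e.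
Qed.

Lemma measurable_rV_affine n (a : 'rV[R]_n) s :
  measurable_fun setT (fun x : 'rV[R]_n => a + s *: x).
Proof.
apply: measurable_fun_rVP => i; under eq_fun do rewrite !mxE.
apply: measurable_funD => //; apply: measurable_funM => //.
exact: measurable_coord.
Qed.

(** Induction on the dimension: splitting off the first coordinate turns the map into [S], and a
    product measure is determined by its values on rectangles. *)
Lemma lebesgue_rV_affine n (a : 'rV[R]_n) s (E : set 'rV[R]_n) :
  s != 0 -> measurable E ->
  lebesgue_rV R n ((fun x => a + s *: x) @^-1` E) =
  ((`|s| ^- n)%:E * lebesgue_rV R n E)%E.
Proof.
move=> s0; have s1 : 0 < `|s| by rewrite normr_gt0.
elim: n => [|n IH] in a E * => mE.
  rewrite expr0 invr1 mul1e; congr (lebesgue_rV R 0 _).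
  by apply/seteqP; split=> x /=; rewrite (thinmx0 (_ + _)) (thinmx0 x).
pose a0 : R := a ord0 ord0; pose a' : 'rV[R]_n := \row_j a ord0 (lift ord0 j).
pose S (p : measurableTypeR R * 'rV[R]_n) : measurableTypeR R * 'rV[R]_n :=
  (a0 + s * p.1 : R, a' + s *: p.2).
have mS : measurable_fun setT S.
  apply/measurable_fun_pairP; split.
    apply: (@measurable_realfun.measurable_funD _ _ R _ (cst a0)
      (fun p : measurableTypeR R * 'rV[R]_n => s * (p.1 : R))) => //.
    apply: (@measurable_realfun.measurable_funM _ _ R _ (cst s)) => //.
  apply: (@measurableT_comp _ _ _ _ _ _ (fun x : 'rV[R]_n => a' + s *: x)) => //.
  exact: measurable_rV_affine.
pose push : {measure set _ -> \bar R} :=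
  measure_function_pushforward__canonical__measure_function_Measure
    ((@lebesgue_measure R \x lebesgue_rV R n)%E : {measure set _ -> \bar R}) mS.
pose k : {nonneg R} := NngNum (exprn_ge0 n.+1 (normr_ge0 s)).
have H X : measurable X -> (@lebesgue_measure R \x lebesgue_rV R n)%E X =
    ((`|s| ^+ n.+1)%:E * push X)%E.
  apply: (@product_measure_unique _ _ _ _ R (@lebesgue_measure R) (lebesgue_rV R n)
    (mscale k push)) => A B mA mB.
  pose A' : set (measurableTypeR R) := (fun t : R => a0 + s * t) @^-1` A.
  pose B' := (fun x : 'rV[R]_n => a' + s *: x) @^-1` B.
  have mB' : measurable B'.
    by rewrite -[X in measurable X]setTI; exact: measurable_rV_affine.
  have mA' : measurable A'.
    by rewrite -[X in measurable X]setTI; apply: measurable_affine.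
  transitivity ((`|s| ^+ n.+1)%:E * (@lebesgue_measure R \x lebesgue_rV R n)
    (A' `*` B'))%E.
    by rewrite (_ : A' `*` B' = S @^-1` (A `*` B))//; apply/seteqP; split=> -[].
  have HA : lebesgue_measure A' = (`|s|^-1%:E * lebesgue_measure A)%E.
    exact: lebesgue_measure_affine.
  have HB : lebesgue_rV R n B' = ((`|s| ^- n)%:E * lebesgue_rV R n B)%E by exact: IH.
  transitivity ((`|s| ^+ n.+1)%:E * (lebesgue_measure A' * lebesgue_rV R n B'))%E.
    by rewrite product_measure1E.
  rewrite HA HB muleACA.
  have K (t u w : R) (x : \bar R) : t * (u * w) = 1 ->
    (t%:E * (u%:E * w%:E * x))%E = x by move=> tuw; rewrite muleA -!EFinM tuw mul1e.
  by apply: K; rewrite exprS mulrACA !divff ?gt_eqF ?exprn_gt0// mulr1.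
rewrite /= /lebesgue_rVS /pushforward -comp_preimage.
rewrite (_ : _ \o _ = @rV_cons R n \o S); last first.
  apply/funext => -[t y]; apply/rowP => i; rewrite /= !mxE.
  by case: unliftP => [j ->|->]/=; rewrite ?mxE.
rewrite comp_preimage (H (@rV_cons R n @^-1` E)).
  by rewrite muleA -EFinM mulVf ?mul1e// gt_eqF// exprn_gt0.
by rewrite -[X in measurable X]setTI; exact: measurable_rV_cons.
Qed.
End affine_change_of_variable.

(** * Sums and measures over a countable index type *)

Section countable_sums.
Context {R : realType} {I : countType}.

Lemma set_bij_pickle (J : set I) : set_bij J (pickle @` J) pickle.
Proof.
split; [by move=> i Ji; exists i| |by []].
by move=> i j _ _; exact: (pcan_inj (@pickleK I)).
Qed.

(** A finite partial sum within [eps] of the supremum that defines [\esum] leaves a tail below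
    [eps]. *)
Lemma esum_tail (m : I -> R) (eps : R) : (forall i, 0 <= m i) ->
  (\esum_(i in [set: I]) (m i)%:E < +oo)%E -> 0 < eps ->
  exists2 F : set I, finite_set F & (\esum_(i in ~` F) (m i)%:E < eps%:E)%E.
Proof.
move=> m0 moo eps0.
have S0 (J : set I) : (0 <= \esum_(i in J) (m i)%:E)%E.
  by apply: esum_ge0 => i _; rewrite lee_fin.
have fin : \esum_(i in [set: I]) (m i)%:E \is a fin_num by rewrite ge0_fin_numE.
have : (\esum_(i in [set: I]) (m i)%:E - eps%:E < \esum_(i in [set: I]) (m i)%:E)%E.
  by rewrite lteBlDr// lteDl// lte_fin.
rewrite {2}/esum => /ereal_sup_gt[_ [F [finF _] <-]] ltF.
exists F => //; rewrite -(esum_fset finF) in ltF; last by move=> i _; rewrite lee_fin.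
move: ltF; rewrite (esumID F); last by move=> i _; rewrite lee_fin.
rewrite !setTI.
have finFs : \esum_(i in F) (m i)%:E \is a fin_num.
  rewrite ge0_fin_numE//; apply: le_lt_trans moo.
  by rewrite [leRHS](esumID F)// ?setTI ?leeDl// => i _; rewrite lee_fin.
by rewrite lteBlDr// lteD2lE.
Qed.

Context {disp : measure_display} {T : measurableType disp}.
Context (mu : {measure set T -> \bar R}).

Lemma measurable_bigcup_countType (J : set I) (A : I -> set T) :
  (forall i, measurable (A i)) -> measurable (\bigcup_(i in J) A i).
Proof.
by move=> mA; rewrite bigcup_mkcond; apply: countable_bigcupT_measurable => [|i];
  [exact: countableP|case: ifP].
Qed.

Lemma measure_bigcup_esum (J : set I) (A : I -> set T) :
  (forall i, measurable (A i)) -> trivIset setT A ->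
  mu (\bigcup_(i in J) A i) = \esum_(i in J) mu (A i).
Proof.
move=> mA tA; pose F n := oapp A set0 (pickle_inv n).
have FE i : F (pickle i) = A i by rewrite /F pickleK_inv.
rewrite (_ : \bigcup_(i in J) A i = \bigcup_(n in pickle @` J) F n); last first.
  by rewrite bigcup_image; apply: eq_bigcupr => i _; rewrite FE.
rewrite measure_bigcup.
- rewrite nneseries_esum// set_mem_set (reindex_esum _ _ _ _ (set_bij_pickle J)).
  by apply: eq_esum => i _; rewrite FE.
- by move=> n [i _ <-]; rewrite FE.
- move=> _ _ [i _ <-] [j _ <-]; rewrite !FE => /tA -> //.
Qed.

Lemma measure_le_esum (J : set I) (A : I -> set T) (B : set T) :
  (forall i, measurable (A i)) -> measurable B -> B `<=` \bigcup_(i in J) A i ->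
  (mu B <= \esum_(i in J) mu (A i))%E.
Proof.
move=> mA mB BA; pose F n := if pickle_inv n is Some i then
  (if i \in J then A i else set0) else set0.
have FE i : F (pickle i) = if i \in J then A i else set0 by rewrite /F pickleK_inv.
have mF n : measurable (F n) by rewrite /F; case: pickle_inv => // i; case: ifP.
apply: (@le_trans _ _ (\sum_(0 <= n <oo) mu (F n))%E).
  apply: measure_sigma_subadditive => // x /BA[i Ji Ax].
  by exists (pickle i) => //; rewrite FE mem_set.
rewrite nneseries_esumT//.
rewrite (eq_esum (_ : forall i, J i -> mu (A i) = mu (F (pickle i)))); last first.
  by move=> i Ji; rewrite FE mem_set.
rewrite -(reindex_esum J (pickle @` J) pickle (mu \o F)); last exact: set_bij_pickle.
rewrite [leRHS]esum_mkcond; apply: le_esum => n _; case: ifPn => // /negP nJ.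
rewrite /F; case E : pickle_inv => [i|]; last by rewrite measure0.
case: ifPn => [iJ|]; last by rewrite measure0.
case: nJ; rewrite inE; exists i; first exact: set_mem.
by have := @pickle_invK I n; rewrite /ocancel E.
Qed.

End countable_sums.

(** * Volumes of convex sets *)

Section dot_product.
Context {R : realType} {d : nat}.
Implicit Types v x y : 'rV[R]_d.

Definition dot v x : R^o := \sum_(k < d) v ord0 k * x ord0 k.

Lemma dot_is_linear v : linear (dot v).
Proof.
move=> a x y; rewrite /dot scaler_sumr -big_split/=; apply: eq_bigr => k _.
by rewrite !mxE mulrDr mulrCA.
Qed.

HB.instance Definition _ v :=
  GRing.isLinear.Build R 'rV[R]_d R^o _ (dot v) (dot_is_linear v).

Lemma dotC v x : dot v x = dot x v.
Proof. by apply: eq_bigr => k _; rewrite mulrC. Qed.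

Lemma dotDr v x y : dot v (x + y) = dot v x + dot v y. Proof. exact: linearD. Qed.
Lemma dotBr v x y : dot v (x - y) = dot v x - dot v y. Proof. exact: linearB. Qed.
Lemma dotZr v (a : R) x : dot v (a *: x) = a * dot v x. Proof. exact: linearZ. Qed.
Lemma dotBl v x y : dot (x - y) v = dot x v - dot y v.
Proof. by rewrite dotC dotBr !(dotC v). Qed.

Lemma dot_gt0 v : v != 0 -> 0 < dot v v.
Proof.
move=> v0; have [k vk] : exists k, v ord0 k != 0.
  by have /matrix0Pn[i [k]] := v0; rewrite (ord1 i); exists k.
rewrite /dot (bigD1 k)//= ltr_pwDl//; first by rewrite -expr2 exprn_even_gt0.
by apply: sumr_ge0 => i _; rewrite -expr2 sqr_ge0.
Qed.

Lemma dot_continuous v : continuous (dot v).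
Proof.
apply: continuous_big => [|k _]; first exact: (@add_continuous R^o).
move=> x; apply: (@continuousM R _ (cst (v ord0 k)) (fun x : 'rV[R]_d => x ord0 k)).
  exact: cst_continuous.
exact: coord_continuous.
Qed.

Lemma open_dot_gt v (c : R) : open [set x | c < dot v x].
Proof.
apply: (@open_comp _ _ (dot v) [set t : R^o | c < t]); last exact: open_gt.
by move=> x _; exact: dot_continuous.
Qed.

Lemma open_dot_lt v (c : R) : open [set x | dot v x < c].
Proof.
apply: (@open_comp _ _ (dot v) [set t : R^o | t < c]); last exact: open_lt.
by move=> x _; exact: dot_continuous.
Qed.

Lemma dot_le_norm (r : R) v x : (forall k, `|x ord0 k| <= r) ->
  `|dot v x| <= (\sum_(k < d) `|v ord0 k|) * r.
Proof.
move=> xr; apply: le_trans (ler_norm_sum _ _ _) _.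
by rewrite mulr_suml; apply: ler_sum => k _; rewrite normrM ler_wpM2l.
Qed.

End dot_product.

Section convexity.
Context {R : realType} {d : nat}.
Implicit Types (A B Omega : set 'rV[R]_d) (x y p u : 'rV[R]_d).

Lemma convex_setP A : convex_set A <-> forall x y (t : R), 0 <= t <= 1 ->
  A x -> A y -> A (t *: x + (1 - t) *: y).
Proof.
split=> [cA x y t /andP[t0 t1] Ax Ay|cA x y t].
  by have := cA x y (Itv01 t0 t1); rewrite !inE => /(_ Ax Ay).
rewrite !inE => Ax Ay; apply: cA => //.
by apply/andP; split; [exact: ge0|exact: le1].
Qed.

Lemma convex_functionP A (f : 'rV[R]_d -> R^o) : convex_function A f <->
  forall x y (t : R), 0 <= t <= 1 -> A x -> A y ->
    f (t *: x + (1 - t) *: y) <= t * f x + (1 - t) * f y.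
Proof.
split=> [cf x y t /andP[t0 t1] Ax Ay|cf t x y].
  by have := cf (Itv01 t0 t1) x y; rewrite !inE => /(_ Ax Ay).
rewrite !inE => Ax Ay; apply: cf => //.
by apply/andP; split; [exact: ge0|exact: le1].
Qed.

(** The remaining weight [1 - \sum_i a i] sits at [x]; the strict bound keeps [1 - a k] positive, so
    the induction can rescale the other weights. *)
Lemma convex_set_sum A n (f : 'I_n -> 'rV[R]_d) (a : 'I_n -> R) x :
  convex_set A -> A x -> (forall i, A (x + f i)) ->
  (forall i, 0 <= a i) -> \sum_i a i < 1 -> A (x + \sum_i a i *: f i).
Proof.
move=> /convex_setP cA Ax Af; elim: (index_enum _) a => [|k s IH] a a0.
  by rewrite !big_nil addr0.
rewrite !big_cons => a1; have S0 : 0 <= \sum_(i <- s) a i by apply: sumr_ge0.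
have ak1 : a k < 1 by lra.
have c0 : 1 - a k != 0 by rewrite gt_eqF// subr_gt0.
have -> : x + (a k *: f k + \sum_(i <- s) a i *: f i) =
    a k *: (x + f k) + (1 - a k) *: (x + \sum_(i <- s) (a i / (1 - a k)) *: f i).
  rewrite [in RHS]scalerDr [(1 - _) *: (_ + _)]scalerDr scaler_sumr.
  under [in RHS]eq_bigr do rewrite scalerA mulrC divfK//.
  by rewrite [in RHS]addrACA -scalerDl [a k + _]addrC subrK scale1r.
apply: cA => //; first by rewrite a0 ltW.
apply: IH => [i|]; first by rewrite divr_ge0// subr_ge0 ltW.
by rewrite -mulr_suml ltr_pdivrMr ?subr_gt0// mul1r ltrBrDl.
Qed.

Lemma open_translate A x : open A -> open [set z | A (x + z)].
Proof.
move=> oA; apply: (@open_comp _ _ (fun z => x + z)) => // z _.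
apply: (@continuousD R _ _ (cst x) id); [exact: cst_continuous|by move=> ?].
Qed.

Lemma open_segment A x u : open A -> A x ->
  exists2 e : R, 0 < e & forall t, `|t| <= e -> A (x + t *: u).
Proof.
move=> oA Ax; have /nbhs_ballP[e/= e0 xeA] : nbhs x A by exact: open_nbhs_nbhs.
have u1 : 0 < `|u| + 1 by rewrite ltr_pwDr.
exists (e / 2 / (`|u| + 1)) => [|t te]; first by rewrite divr_gt0// divr_gt0.
apply: xeA; rewrite -ball_normE /= opprD addNKr normrN normrZ.
move: te; rewrite ler_pdivlMr// mulrDr mulr1 => te.
have := normr_ge0 t; lra.
Qed.

(** The homothety of centre [x] and ratio [t] maps a ball of radius [e] at [p] to one of radius
    [t * e], still inside [A]. *)
Lemma interior_segment A x p (t : R) : convex_set A -> A° p -> A x -> 0 < t <= 1 ->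
  A° (x + t *: (p - x)).
Proof.
move=> /convex_setP cA /nbhs_ballP[e/= e0 peA] Ax /andP[t0 t1].
apply/nbhs_ballP; exists (t * e) => /=; first by rewrite mulr_gt0.
move=> y; rewrite -ball_normE/= => xy.
have -> : y = t *: (x + t^-1 *: (y - x)) + (1 - t) *: x.
  by apply/rowP => k; rewrite !mxE; field; lra.
apply: cA => //; first by rewrite ltW.
apply: peA; rewrite -ball_normE/= -(ltr_pM2l t0).
rewrite -[X in X * `|_|](gtr0_norm t0) -normrZ (_ : _ *: _ = x + t *: (p - x) - y)//.
by apply/rowP => k; rewrite !mxE; field; lra.
Qed.

Lemma convex_set_interior A : convex_set A -> convex_set A°.
Proof.
move=> cA; apply/convex_setP => x y t /andP[t0 t1] Ax Ay.
have [->|tn0] := eqVneq t 0; first by rewrite scale0r add0r subr0 scale1r.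
rewrite (_ : _ + _ = y + t *: (x - y)); last first.
  by apply/rowP => k; rewrite !mxE; ring.
by apply: interior_segment (interior_subset Ay) _ => //; rewrite lt_neqAle eq_sym tn0 t0.
Qed.

End convexity.

Section convex_measure.
Context {R : realType} {d : nat}.
Implicit Types (A B Omega : set 'rV[R]_d) (x y p u : 'rV[R]_d).

Lemma bernoulli_le n (u : R) : 0 <= u <= 1 -> 1 - u * n%:R <= (1 - u) ^+ n.
Proof.
move=> /andP[u0 u1]; elim: n => [|n IH]; first by rewrite mulr0 subr0 expr0.
have : (1 - u) * (1 - u * n%:R) <= (1 - u) ^+ n.+1.
  by rewrite exprS ler_wpM2l// subr_ge0.
apply: le_trans; rewrite -natr1.
have : 0 <= u * u * n%:R by rewrite !mulr_ge0.
lra.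
Qed.

Lemma ler_scale_lim n (a b : R) : 0 <= b ->
  (forall s, 0 < s < 1 -> s ^+ n * a <= b) -> a <= b.
Proof.
move=> b0 scale; rewrite leNgt; apply/negP => ba.
(* For [s = 1 - t] Bernoulli's inequality bounds the loss by [t * n * a], less than half the gap
   [a - b]; [n.+1] avoids dividing by zero. *)
pose t : R := (a - b) / (2 * a * n.+1%:R).
have D0 : (0 : R) < n.+1%:R by rewrite ltr0n.
have D1 : 1 <= n.+1%:R :> R by rewrite ler1n.
have nD : (n%:R : R) = n.+1%:R - 1 by rewrite -natr1 addrK.
have t0 : 0 < t by rewrite divr_gt0 ?mulr_gt0//; lra.
have tD : t * n.+1%:R * a = (a - b) / 2.
  by rewrite /t; field; apply/andP; split; lra.
have t1 : t < 1.
  rewrite /t ltr_pdivrMr ?mulr_gt0//; [nra|lra].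
have sc : (1 - t) ^+ n * a <= b by apply: scale; lra.
have br : 1 - t * (n.+1%:R - 1) <= (1 - t) ^+ n by rewrite -nD bernoulli_le//; lra.
have : (1 - t * (n.+1%:R - 1)) * a <= (1 - t) ^+ n * a by rewrite ler_wpM2r//; lra.
nra.
Qed.

(* The homothety of centre [p] and ratio [s < 1] maps [B] into its interior, and
   it multiplies volumes by [s ^+ d]. *)
Lemma lebesgue_rV_interior B p : convex_set B -> measurable B ->
  (lebesgue_rV R d B < +oo)%E -> B° p ->
  lebesgue_rV R d B° = lebesgue_rV R d B.
Proof.
move=> cB mB Boo Bp; have mBi : measurable B°.
  by apply: open_measurable_rV; exact: open_interior.
have le_int : (lebesgue_rV R d B° <= lebesgue_rV R d B)%E.
  by apply: le_measure; rewrite ?inE//; exact: interior_subset.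
have scale (s : R) : 0 < s < 1 ->
    ((s ^+ d)%:E * lebesgue_rV R d B <= lebesgue_rV R d B°)%E.
  move=> /andP[s0 s1]; have sV0 : s^-1 != 0 by rewrite invr_neq0 ?gt_eqF.
  have := lebesgue_rV_affine d (p - s^-1 *: p) _ B sV0 mB.
  rewrite normfV gtr0_norm// exprVn invrK => <-.
  apply: le_measure; rewrite ?inE//.
    by rewrite -[X in measurable X]setTI; exact: measurable_rV_affine.
  move=> y /= By.
  have -> : y = (p - s^-1 *: p + s^-1 *: y) +
      (1 - s) *: (p - (p - s^-1 *: p + s^-1 *: y)).
    by apply/rowP => k; rewrite !mxE; field; rewrite gt_eqF.
  apply: interior_segment => //.
  by rewrite subr_gt0 s1/= lerBlDr lerDl ltW.
have finB : lebesgue_rV R d B \is a fin_num by rewrite ge0_fin_numE.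
have finBi : lebesgue_rV R d B° \is a fin_num.
  by rewrite ge0_fin_numE//; exact: le_lt_trans le_int Boo.
apply/eqP; rewrite eq_le le_int/= -(fineK finB) -(fineK finBi) lee_fin.
apply: (ler_scale_lim d); first by rewrite fine_ge0.
by move=> s s01; rewrite -lee_fin EFinM !fineK//; exact: scale.
Qed.

(** Take a maximal independent family of vectors [x - x0] with [x] in [B]. If it spans, [B] contains
    a full simplex; otherwise [B] lies in [x0] plus a proper subspace. *)
Lemma convex_interior_or_hyperplane B x0 : convex_set B -> B x0 ->
  (exists p, B° p) \/
  (exists2 w : 'rV[R]_d, w != 0 & forall x, B x -> dot w x = dot w x0).
Proof.
move=> /convex_setP cB Bx0.
pose P k := `[< exists2 M : 'M[R]_(k, d), row_free M & forall i, B (x0 + row i M) >].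
have exP : exists k, P k.
  by exists 0%N; apply/asboolP; exists 0; [rewrite /row_free mxrank0|case].
have leP k : P k -> (k <= d)%N.
  by move=> /asboolP[M /eqP Mk _]; rewrite -Mk; exact: rank_leq_col.
case: (ex_maxnP exP leP) => k /asboolP[M Mfree MB] kmax.
(* Otherwise [x - x0] could be appended to [M], against maximality. *)
have Bsub x : B x -> (x - x0 <= M)%MS.
  move=> Bx; apply/negPn/negP => xM.
  suff /kmax : P k.+1 by rewrite ltnn.
  rewrite -addn1; apply/asboolP; exists (col_mx M (x - x0)).
    have : (M < col_mx M (x - x0))%MS.
      by rewrite /ltmx -!addsmxE addsmxSl/= addsmx_sub submx_refl.
    move/rank_ltmx; rewrite (eqP Mfree) => lt_rank.
    by rewrite /row_free eqn_leq rank_leq_row/= [X in (X <= _)%N]addn1.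
  move=> i; case: (splitP i) => j ij.
    rewrite (_ : i = lshift 1 j); last exact/val_inj.
    by rewrite rowKu.
  rewrite (_ : i = rshift k j); last exact/val_inj.
  by rewrite rowKd row_id addrC subrK.
have [kd|kd] := ltnP k d; [right|left].
  (* Columns of [cokermx M] are orthogonal to the rows of [M], so a nonzero one is a normal
     vector. *)
  have : cokermx M != 0.
    by rewrite -mxrank_eq0 mxrank_coker (eqP Mfree) subn_eq0 -ltnNge.
  case/matrix0Pn => i [j Mij]; exists (col j (cokermx M))^T.
    apply/matrix0Pn; by exists ord0, i; rewrite 2!mxE.
  move=> x /Bsub /submxP[D xD]; apply/eqP; rewrite -subr_eq0 -dotBr xD.
  have : D *m M *m cokermx M = 0 by rewrite -mulmxA mulmx_coker mulmx0.
  move/matrixP/(_ ord0 j); rewrite [RHS]mxE => <-; rewrite mxE; apply/eqP/eq_bigr => l _.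
  by rewrite mulrC; congr (_ * _); rewrite 2!mxE.
have {kd} kd : k = d by apply/eqP; rewrite eqn_leq kd andbT -(eqP Mfree) rank_leq_col.
move: M Mfree MB {Bsub kmax}; rewrite {}kd => M Mfree MB.
have Munit : M \in unitmx by rewrite -row_free_unit.
pose c i : 'rV[R]_d := (col i (invmx M))^T.
have coordM y : y = x0 + \sum_i dot (c i) (y - x0) *: row i M.
  rewrite -[LHS](subrK x0) addrC; congr (_ + _).
  rewrite -[LHS]mulmx1 -(mulVmx Munit) mulmxA [LHS]mulmx_sum_row.
  apply: eq_bigr => i _; congr (_ *: _); rewrite mxE; apply: eq_bigr => j _.
  by rewrite mulrC; congr (_ * _); rewrite 2!mxE.
(* The witness is the barycentre of the simplex. Its coordinates [q] in the dual basis [c] are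
   positive with sum below 1, and both conditions are open. *)
pose q : R := d.+1%:R^-1.
have q0 : 0 < q by rewrite invr_gt0 ltr0n.
exists (x0 + \sum_i q *: row i M).
have cq i : dot (c i) (\sum_i q *: row i M) = q.
  have cM j : dot (c i) (row j M) = (j == i)%:R.
    have := mulmxV Munit => /matrixP/(_ j i); rewrite [RHS]mxE => <-; rewrite mxE.
    by apply: eq_bigr => l _; rewrite mulrC [row j M _ _]mxE 2!mxE.
  rewrite linear_sum/= (bigD1 i)//= dotZr cM eqxx mulr1 big1 ?addr0// => j ji.
  by rewrite dotZr cM (negbTE ji) mulr0.
have near_pos : \forall y \near x0 + \sum_i q *: row i M,
    forall i, dot (c i) x0 < dot (c i) y.
  apply: (@filter_forall _ _ (fun i => [set y | dot (c i) x0 < dot (c i) y]) _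
    (nbhs_filter _)) => i; apply: open_nbhs_nbhs; split; first exact: open_dot_gt.
  by rewrite /= dotDr cq ltrDl.
have near_sum : \forall y \near x0 + \sum_i q *: row i M,
    dot (\sum_i c i) y < 1 + dot (\sum_i c i) x0.
  apply: open_nbhs_nbhs; split; first exact: open_dot_lt.
  rewrite /= dotDr addrC ltrD2r dotC linear_sum/=.
  under eq_bigr do rewrite dotC cq.
  rewrite sumr_const card_ord -[q *+ d]mulr_natr mulrC ltr_pdivrMr ?ltr0n//.
  by rewrite mul1r ltr_nat.
apply: (filterS _ (filterI near_pos near_sum)) => y [/= ypos ysum]; rewrite (coordM y).
apply: convex_set_sum => //; first exact/convex_setP.
  by move=> i; rewrite dotBr subr_ge0 ltW.
move: ysum; rewrite -ltrBlDr -dotBr dotC linear_sum/=.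
by under eq_bigr do rewrite dotC.
Qed.

End convex_measure.

Section null_sets.
Context {R : realType} {d : nat}.
Implicit Types (A B Omega : set 'rV[R]_d) (x y p u : 'rV[R]_d).

Lemma measurable_dot_eq (w : 'rV[R]_d) (c : R) : measurable [set x | dot w x = c].
Proof.
rewrite (_ : [set _ | _] = ~` ([set x | c < dot w x] `|` [set x | dot w x < c])).
  apply: measurableC; apply: measurableU; apply: open_measurable_rV.
    exact: open_dot_gt.
  exact: open_dot_lt.
apply/seteqP; split=> x /=; first by move=> ->; rewrite ltxx; case.
by move=> /not_orP[/negP + /negP]; rewrite -!leNgt => ? ?; apply/le_anti/andP.
Qed.

Lemma measurable_dot_le (w : 'rV[R]_d) (c : R) : measurable [set x | dot w x <= c].
Proof.
rewrite (_ : [set _ | _] = ~` [set x | c < dot w x]).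
  by apply: measurableC; apply: open_measurable_rV; exact: open_dot_gt.
by apply/seteqP; split=> x /=; rewrite leNgt => /negP.
Qed.

(** The slice lies in [B] minus its interior, where [B] is the part of [Omega] on one side. As [B]
    is convex with interior points, that difference is null. *)
Lemma lebesgue_rV_hyperplane Omega (w : 'rV[R]_d) (c : R) : open Omega ->
  convex_set Omega -> bounded_set Omega -> w != 0 ->
  lebesgue_rV R d (Omega `&` [set x | dot w x = c]) = 0%E.
Proof.
move=> oO cO bO w0; set H := _ `&` _.
have mO := open_measurable_rV Omega oO.
have [->|/set0P[x [Ox xc]]] := eqVneq H set0; first by rewrite measure0.
pose B := Omega `&` [set x | dot w x <= c].
have mB : measurable B by apply: measurableI => //; exact: measurable_dot_le.
have mH : measurable H by apply: measurableI => //; exact: measurable_dot_eq.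
have Boo : (lebesgue_rV R d B < +oo)%E.
  apply: le_lt_trans (bounded_lebesgue_rV Omega bO mO).
  by apply: le_measure; rewrite ?inE//; exact: subIsetl.
have [p Bp] : exists p, B° p.
  have [e e0 xe] := open_segment _ x w oO Ox.
  exists (x + (- e) *: w).
  apply: (@filterS _ _ _ (Omega `&` [set x | dot w x < c])).
    by move=> y [Oy /ltW yc]; split.
  apply: open_nbhs_nbhs; split.
    by apply: openI => //; exact: open_dot_lt.
  split; first by apply: xe; rewrite normrN gtr0_norm.
  by rewrite /= dotDr dotZr xc mulNr gtrDl oppr_lt0 mulr_gt0// dot_gt0.
have cB : convex_set B.
  move/convex_setP: cO => cO; apply/convex_setP => a b t t01 [Oa /= ac] [Ob /= bc].
  split; first exact: cO.
  rewrite /= dotDr !dotZr; move: t01 => /andP[t0 t1].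
  have := ler_wpM2l t0 ac; have : (1 - t) * dot w b <= (1 - t) * c.
    by rewrite ler_wpM2l// subr_ge0.
  by lra.
have mBi : measurable B° by apply: open_measurable_rV; exact: open_interior.
have HB : H `<=` B `\` B°.
  move=> y [Oy /= yc]; split; first by split => //=; rewrite yc.
  move=> Biy; have [e e0 ye] := open_segment _ y w (open_interior B) Biy.
  have [_ /=] : B (y + e *: w) by apply: interior_subset; apply: ye; rewrite gtr0_norm.
  by rewrite dotDr dotZr yc gerDl leNgt mulr_gt0// dot_gt0.
apply/eqP; rewrite eq_le measure_ge0 andbT.
apply: (@le_trans _ _ (lebesgue_rV R d (B `\` B°))).
  by apply: le_measure; rewrite ?inE//; exact: measurableD.
rewrite measureD// setIidr; last exact: interior_subset.
rewrite [X in (_ - X <= _)%E](lebesgue_rV_interior B p)//.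
by rewrite subee// ge0_fin_numE.
Qed.

(** A convex set without interior points lies in a hyperplane, hence is null. *)
Lemma lebesgue_rV_convex_interior Omega B : open Omega -> convex_set Omega ->
  bounded_set Omega -> convex_set B -> measurable B -> B `<=` Omega ->
  lebesgue_rV R d B° = lebesgue_rV R d B.
Proof.
move=> oO cO bO cB mB BO; have mO := open_measurable_rV Omega oO.
have mBi : measurable B° by apply: open_measurable_rV; exact: open_interior.
have Boo : (lebesgue_rV R d B < +oo)%E.
  apply: le_lt_trans (bounded_lebesgue_rV Omega bO mO).
  by apply: le_measure; rewrite ?inE.
have [B0|/set0P[x0 Bx0]] := eqVneq B set0.
  by rewrite (_ : B° = B)//; apply/seteqP; split=> [|x]; [exact: interior_subset|rewrite B0].
have [[p Bp]|[w w0 Bw]] := convex_interior_or_hyperplane B x0 cB Bx0.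
  exact: lebesgue_rV_interior Bp.
have B0 : lebesgue_rV R d B = 0%E.
  apply/eqP; rewrite eq_le measure_ge0 andbT.
  rewrite -(lebesgue_rV_hyperplane Omega w (dot w x0) oO cO bO w0).
  apply: le_measure; rewrite ?inE//.
    by apply: measurableI => //; exact: measurable_dot_eq.
  by move=> x Bx; split; [exact: BO|exact: Bw].
apply/eqP; rewrite eq_le B0 measure_ge0 andbT -B0.
by apply: le_measure; rewrite ?inE//; exact: interior_subset.
Qed.

(** This moves countably many points off a null set at once: for each [k] the bad [z] form a null
    affine preimage of [N], while [U] has positive volume. *)
Lemma generic_point (N U : set 'rV[R]_d) x (a : nat -> 'rV[R]_d) (s : nat -> R) :
  measurable N -> lebesgue_rV R d N = 0%E -> open U -> U x ->
  (forall k, s k != 0) ->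
  exists2 z, U z & forall k, ~ N (a k + s k *: z).
Proof.
move=> mN N0 oU Ux s0; apply: contrapT => nz.
pose F k := (fun z => a k + s k *: z) @^-1` N.
have mF k : measurable (F k).
  by rewrite -[X in measurable X]setTI; exact: measurable_rV_affine.
have F0 : lebesgue_rV R d (\bigcup_k F k) = 0%E.
  apply: measure_negligible; first exact: bigcup_measurable.
  apply: negligible_bigcup => k; apply/negligibleP => //.
  by have := lebesgue_rV_affine d (a k) _ N (s0 k) mN; rewrite N0 mule0.
have := open_lebesgue_rV_gt0 U x oU Ux; rewrite ltNge => /negP; apply.
rewrite -F0; apply: le_measure; rewrite ?inE//.
- exact: open_measurable_rV.
- exact: bigcup_measurable.
- move=> z Uz; apply: contrapT => Fz; apply: nz; exists z => // k Nk; apply: Fz.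
  by exists k.
Qed.

End null_sets.

(** * Subgradients *)

Section subgradient.
Context {R : realType} {d : nat}.
Implicit Types (Omega : set 'rV[R]_d) (x y w u h : 'rV[R]_d) (phi psi : 'rV[R]_d -> R^o).

Definition subgradient Omega phi x w :=
  forall y, Omega y -> phi x + dot w (y - x) <= phi y.

Lemma derive_gradient phi x u : differentiable phi x ->
  'D_u phi x = dot (gradient phi x) u.
Proof.
move=> dphi; rewrite deriveE// {1}(row_sum_delta u) linear_sum/=.
apply: eq_bigr => k _; rewrite linearZ/= /gradient mxE deriveE// mulrC.
by [].
Qed.

(** By convexity the difference quotients from [x] towards [y] are at most [phi y - phi x]; let the
    step tend to zero from the right. *)
Lemma has_gradient_subgradient Omega phi x w : convex_set Omega ->
  convex_function Omega phi -> Omega x -> has_gradient phi x w ->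
  subgradient Omega phi x w.
Proof.
move=> /convex_setP cO /convex_functionP cphi Ox [dphi <-] y Oy.
rewrite -lerBrDl -derive_gradient//.
have := @diff_derivable _ _ _ phi x (y - x) dphi.
rewrite /derivable -/(derive phi x (y - x)) => /cvg_dnbhs_at_right.
move/cvgr_to_le; apply; near=> h.
have h0 : 0 < h by near: h; exact: nbhs_right_gt.
have h1 : h <= 1 by near: h; apply: nbhs_right_le.
rewrite /= [h *: _]/(_ *: _) -[_ *: _]/(h^-1 * _) mulrC ler_pdivrMr//.
have -> : h *: (y - x) + x = h *: y + (1 - h) *: x.
  by apply/rowP => k; rewrite !mxE; ring.
have := cphi y x h; rewrite h1 ltW// => /(_ isT Oy Ox); lra.
Unshelve. all: end_near.
Qed.

Lemma subgradient_mono Omega phi x y w w' : Omega x -> Omega y ->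
  subgradient Omega phi x w -> subgradient Omega phi y w' ->
  dot w (y - x) <= dot w' (y - x).
Proof.
move=> Ox Oy /(_ y Oy) + /(_ x Ox); rewrite -[x - y]opprB.
by rewrite [dot w' (- _)]linearN/=; lra.
Qed.

(* Two convex functions with common subgradients grow by the same amount along a
   step [h], up to the increase of [w . h]; these errors telescope. *)
Lemma subgradient_chain Omega phi psi n (z : nat -> 'rV[R]_d) h w0 w1 :
  (forall k, z k.+1 = z k + h) ->
  (forall k, (k <= n.+1)%N -> Omega (z k) /\
    exists w, subgradient Omega phi (z k) w /\ subgradient Omega psi (z k) w) ->
  subgradient Omega psi (z 0%N) w0 -> subgradient Omega phi (z 0%N) w0 ->
  subgradient Omega psi (z n.+1) w1 -> subgradient Omega phi (z n.+1) w1 ->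
  (psi (z n.+1) - phi (z n.+1)) - (psi (z 0%N) - phi (z 0%N)) <= dot w1 h - dot w0 h.
Proof.
move=> zS; have step k w w' : Omega (z k) -> Omega (z k.+1) ->
    subgradient Omega phi (z k) w -> subgradient Omega psi (z k.+1) w' ->
    (psi (z k.+1) - phi (z k.+1)) - (psi (z k) - phi (z k)) <= dot w' h - dot w h.
  move=> Oz Oz' /(_ _ Oz') + /(_ _ Oz); rewrite zS.
  rewrite (_ : z k + h - z k = h); last by rewrite addrAC subrr add0r.
  rewrite (_ : z k - (z k + h) = - h); last by rewrite opprD addNKr.
  by rewrite linearN/=; lra.
elim: n w1 => [|n IH] w1 zG psi0 phi0 psi1 phi1.
  by apply: step => //; have [] := zG 0%N isT; have [] := zG 1%N isT.
have [Oz [w [phiw psiw]]] := zG n.+1 (leqnSn _).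
have [Oz' _] := zG n.+2 (leqnn _).
have := IH w (fun k kn => zG k (leqW kn)) psi0 phi0 psiw phiw.
have := step n.+1 w w1 Oz Oz' phiw psi1; lra.
Qed.

(** By convexity [psi x] is at most the mean of [psi], that is of [phi + e], at [x + t *: u] and
    [x - t *: u]. Slopes along [u] are monotone, so those at [t = 1] and [t = -1] bound the excess
    of the mean of [phi] over [phi x] by [t * C]. *)
Lemma convex_le_dense Omega phi psi (e : R) x u : convex_function Omega psi ->
  Omega x -> (forall t : R, `|t| <= 1 -> Omega (x + t *: u)) ->
  (forall n (t : R), `|t| = n.+1%:R^-1 -> psi (x + t *: u) = phi (x + t *: u) + e /\
    exists w, subgradient Omega phi (x + t *: u) w) ->
  psi x <= phi x + e.
Proof.
move=> /convex_functionP cpsi Ox Ou near_x.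
have [|eq1 [w1 phi1]] := near_x 0%N 1; first by rewrite normr1 invr1.
have [|eq1' [w1' phi1']] := near_x 0%N (-1); first by rewrite normrN normr1 invr1.
apply/ler_addgt0Pr => /= eps eps0.
pose C : R := dot w1 u - dot w1' u.
(* This gives [t * C <= eps]; the additional [.+1] ensures [t < 1], so that [1 - t] can be cancelled
   when slopes are compared. *)
pose n := (Num.truncn (`|C| / eps : R)).+1; pose t : R := n.+1%:R^-1.
have t0 : 0 < t by rewrite invr_gt0 ltr0n.
have t1 : t < 1 by rewrite invf_lt1 ?ltr0n// ltr1n.
have [|eqt [w phiw]] := near_x n t; first by rewrite gtr0_norm.
have [|eqt' [w' phiw']] := near_x n (- t); first by rewrite normrN gtr0_norm.
have Ot : Omega (x + t *: u) by apply: Ou; rewrite gtr0_norm ?ltW.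
have Ot' : Omega (x + (- t) *: u) by apply: Ou; rewrite normrN gtr0_norm ?ltW.
have O1 : Omega (x + 1 *: u) by apply: Ou; rewrite normr1.
have O1' : Omega (x + (- 1) *: u) by apply: Ou; rewrite normrN normr1.
have Ct : t * C <= eps.
  have Cn : `|C| / eps < n.+1%:R.
    by apply: lt_le_trans (truncnS_gt _) _; rewrite ler_nat ltnW// ltnS.
  rewrite mulrC ler_pdivrMr ?ltr0n// mulrC -ler_pdivrMr//.
  by apply: le_trans (ltW Cn); rewrite ler_pM2r ?invr_gt0// ler_norm.
have dotD r r' w2 : dot w2 (x + r *: u - (x + r' *: u)) = (r - r') * dot w2 u.
  by rewrite -dotZr; congr dot; apply/rowP => k; rewrite !mxE; ring.
have := subgradient_mono Omega phi _ _ w w1 Ot O1 phiw phi1.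
have := subgradient_mono Omega phi _ _ w1' w' O1' Ot' phi1' phiw'.
have := phiw' _ Ot; have := phiw x Ox.
rewrite !dotD (_ : x - (x + t *: u) = - t *: u); last first.
  by apply/rowP => k; rewrite !mxE; ring.
rewrite dotZr => phix phit le_w' le_w.
have mid : psi x <= 2^-1 * psi (x + t *: u) + (1 - 2^-1) * psi (x + (- t) *: u).
  have := cpsi (x + t *: u) (x + (- t) *: u) 2^-1.
  rewrite (_ : _ + (1 - _) *: _ = x); first by apply => //; lra.
  by apply/rowP => k; rewrite !mxE; field.
have wle : dot w u <= dot w1 u.
  by rewrite -(ler_pM2l (_ : 0 < 1 - t)) ?subr_gt0.
have wge : dot w1' u <= dot w' u.
  by rewrite -(ler_pM2l (_ : 0 < 1 - t)) ?subr_gt0//; lra.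
move: phix phit mid; rewrite eqt eqt' => phix phit mid.
have : t * dot w u <= t * dot w1 u by rewrite ler_wpM2l// ltW.
have : t * dot w1' u <= t * dot w' u by rewrite ler_wpM2l// ltW.
by move: Ct; rewrite /C mulrBr; lra.
Qed.

End subgradient.

Section affine_functions.
Context {R : realType} {d : nat}.
Implicit Types (phi : 'rV[R]_d -> R^o) (x w : 'rV[R]_d).

(** The remainder of the expansion with linear part [dot w] vanishes near 0, and the differential is
    unique. *)
Lemma near_affine_gradient phi x w (c : R) :
  (\forall y \near x, phi y = dot w y + c) -> has_gradient phi x w.
Proof.
move=> phix; have phixx : phi x = dot w x + c := nbhs_singleton phix.
have dotw : continuous (dot w) by exact: dot_continuous.
have loc : phi \o shift x = cst (phi x) + dot w +o_ (0 : 'rV[R]_d) id.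
  apply/eqaddoP => /= eps eps0.
  have : \forall y \near (0 : 'rV[R]_d), phi (y + x) = dot w (y + x) + c.
    by rewrite (near_shift x); near=> y; rewrite /= sub0r subrK; near: y.
  apply: filterS => y phiy.
  suff -> : (phi \o shift x - (cst (phi x) + dot w)) y = 0.
    by rewrite normr0 mulr_ge0// ltW.
  rewrite -[LHS]/(phi (y + x) - (phi x + dot w y)) phiy phixx dotDr.
  by apply/eqP; rewrite subr_eq0 [dot w y + _]addrC addrAC.
have diffw : 'd phi x = dot w :> (_ -> _) := diff_unique dotw loc.
have dphi : differentiable phi x by apply/diff_locallyP; rewrite diffw.
split=> //; apply/rowP => k; rewrite mxE deriveE// diffw /dot (bigD1 k)//=.
rewrite mxE !eqxx mulr1 big1 ?addr0// => j jk.
by rewrite mxE (negbTE jk) andbF mulr0.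
Unshelve. all: by end_near. Qed.

End affine_functions.

(** * Uniqueness *)

Section cells.
Context {R : realType} {d : nat} (Omega : set 'rV[R]_d).
Context {I : countType} (v : I -> 'rV[R]_d) (m : I -> R).
Hypotheses (openO : open Omega) (convexO : convex_set Omega).
Hypotheses (boundedO : bounded_set Omega) (injv : injective v).
Hypothesis (m_gt0 : forall i, 0 < m i).
Hypothesis (sum_m : \esum_(i in [set: I]) (m i)%:E = lebesgue_rV R d Omega).
Implicit Types (phi psi : 'rV[R]_d -> R^o) (A B : I -> set 'rV[R]_d) (b c : I -> R).

(** A form shared by given solutions and by the [potential] constructed below: affine pieces with
    heights [c], each supporting [phi] from below. *)
Record affine_cells phi A c : Prop := {
  cells_open : forall i, open (A i);
  cells_sub : forall i, A i `<=` Omega;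
  cells_measure : forall i, lebesgue_rV R d (A i) = (m i)%:E;
  cells_disjoint : trivIset setT A;
  cells_eq : forall i x, A i x -> phi x = dot (v i) x + c i;
  cells_le : forall i y, Omega y -> dot (v i) y + c i <= phi y }.

Arguments cells_open {phi A c}.
Arguments cells_sub {phi A c}.
Arguments cells_measure {phi A c}.
Arguments cells_disjoint {phi A c}.
Arguments cells_eq {phi A c}.
Arguments cells_le {phi A c}.

Let mO : measurable Omega := open_measurable_rV Omega openO.

Lemma measure_neq0_nonempty (A : set 'rV[R]_d) (e : R) : 0 < e ->
  lebesgue_rV R d A = e%:E -> exists x, A x.
Proof.
move=> e0 Ae; apply/set0P/negP => /eqP A0; move: Ae; rewrite A0 measure0.
by move=> [e00]; move: e0; rewrite -e00 ltxx.
Qed.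

(** Gradients are subgradients, and the two subgradient inequalities between points of [A i] force
    [phi] to be affine there. A point of two cells would have two gradients, against [injv]. *)
Lemma convex_with_gradients_cells phi : convex_with_gradients Omega v m phi ->
  exists A c, affine_cells phi A c.
Proof.
move=> [_ cphi /choice[A HA]].
have sg i x y : A i x -> Omega y -> phi x + dot (v i) (y - x) <= phi y.
  have [_ _ AO _ gA] := HA i => Ax Oy.
  by apply: has_gradient_subgradient (Oy) => //; [exact: AO|exact: gA].
have /choice[a Aa] i : exists x, A i x.
  by have [_ _ _ + _] := HA i; exact: measure_neq0_nonempty.
exists A, (fun i => phi (a i) - dot (v i) (a i)); split.
- by move=> i; have [] := HA i.
- by move=> i; have [] := HA i.
- by move=> i; have [] := HA i.
- move=> i j _ _ [x [Ax Ay]]; apply: injv.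
  have [_ _ _ _ /(_ x Ax)[_ <-]] := HA i.
  by have [_ _ _ _ /(_ x Ay)[_ <-]] := HA j.
- move=> i x Ax; have [_ _ AO _ _] := HA i.
  have := sg i x (a i) Ax (AO _ (Aa i)); have := sg i (a i) x (Aa i) (AO _ Ax).
  by rewrite !dotBr => h1 h2; apply/le_anti/andP; split; lra.
- by move=> i y Oy; have := sg i (a i) y (Aa i) Oy; rewrite dotBr; lra.
Qed.

Lemma cells_measurable phi A c i : affine_cells phi A c -> measurable (A i).
Proof. by move=> /cells_open/(_ i)/open_measurable_rV. Qed.

Lemma measure_bigcup_cells phi A c (J : set I) : affine_cells phi A c ->
  lebesgue_rV R d (\bigcup_(i in J) A i) = \esum_(i in J) (m i)%:E.
Proof.
move=> cA; have := measure_bigcup_esum (lebesgue_rV R d) J A.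
move=> -> //; last exact: cells_disjoint cA.
  by apply: eq_esum => i _; exact: cells_measure cA i.
by move=> i; exact: cells_measurable cA.
Qed.

Lemma cells_cover phi A c : affine_cells phi A c ->
  lebesgue_rV R d (Omega `\` \bigcup_i A i) = 0%E.
Proof.
move=> cA; have mA : measurable (\bigcup_i A i).
  by apply: measurable_bigcup_countType => i; exact: cells_measurable cA.
have AO : \bigcup_i A i `<=` Omega by move=> x [i _ /(cells_sub cA)].
rewrite measureD//; last exact: bounded_lebesgue_rV.
rewrite setIidr// [X in (_ - X)%E](measure_bigcup_cells phi A c)// sum_m subee//.
by rewrite ge0_fin_numE//; exact: bounded_lebesgue_rV.
Qed.

(** * Comparison of two solutions *)

Section two_potentials.
Context phi A c psi B b.
Hypotheses (cA : affine_cells phi A c) (cB : affine_cells psi B b).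

(** At a common point the [k]-th piece of [phi] lies below its [j]-th, and the [j]-th piece of [psi]
    below its [k]-th; add the two inequalities. *)
Lemma offset_le j k : A j `&` B k !=set0 -> b j - c j <= b k - c k.
Proof.
move=> [y [Ay By]]; have Oy := cells_sub cA j y Ay.
have := cells_eq cA j y Ay; have := cells_eq cB k y By.
have := cells_le cA k y Oy; have := cells_le cB j y Oy; lra.
Qed.

(* The union of the cells [B k] with offset above that of [i] contains, up to a
   null set, the union of the corresponding [A k]; both have the same volume, so
   there is no room left for [A i `&` B k]. *)
Lemma offset_eq i k : A i `&` B k !=set0 -> b k - c k = b i - c i.
Proof.
move=> ABik; apply/le_anti/andP; split; last exact: offset_le.
rewrite leNgt; apply/negP => lt_ik.
pose J : set I := [set j | b i - c i < b j - c j].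
pose S := \bigcup_(j in J) A j; pose T := \bigcup_(j in J) B j.
pose N := Omega `\` \bigcup_j B j; pose V := A i `&` B k.
have mA j : measurable (A j) by exact: cells_measurable cA.
have mB j : measurable (B j) by exact: cells_measurable cB.
have mS : measurable S by exact: measurable_bigcup_countType.
have mT : measurable T by exact: measurable_bigcup_countType.
have mN : measurable N by apply: measurableD => //; exact: measurable_bigcup_countType.
have mV : measurable V by exact: measurableI.
have VT : V `<=` T by move=> x [_ Bx]; exists k.
have ST : S `<=` T `|` N.
  move=> x [j Jj Ax]; have Ox := cells_sub cA j x Ax.
  have [[l _ Bx]|nBx] := pselect ((\bigcup_j B j) x); last by right; split.
  left; exists l => //; apply: lt_le_trans Jj _; apply: offset_le.
  by exists x.
have SV : S `&` V = set0.
  rewrite -subset0 => x [[j Jj Ax] [Aix _]].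
  have ij : i = j by apply: (cells_disjoint cA) => //; exists x.
  by move: Jj; rewrite /J/= ij ltxx.
have le_TS : (lebesgue_rV R d (S `|` V) <= lebesgue_rV R d S)%E.
  rewrite [leRHS](_ : _ = lebesgue_rV R d T); last first.
    by rewrite (measure_bigcup_cells phi A c)// (measure_bigcup_cells psi B b).
  apply: (@le_trans _ _ (lebesgue_rV R d (T `|` N))).
    apply: le_measure; rewrite ?inE; [exact: measurableU|exact: measurableU|].
    by rewrite subUset; split=> // x /VT; left.
  rewrite measureU0//; exact: cells_cover cB.
have Soo : lebesgue_rV R d S \is a fin_num.
  rewrite ge0_fin_numE//; apply: le_lt_trans (bounded_lebesgue_rV Omega boundedO mO).
  by apply: le_measure; rewrite ?inE// => x [j _ /(cells_sub cA)].
move: le_TS; rewrite measureU// leNgt lteDl// => /negP; apply.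
have [x Vx] := ABik; apply: open_lebesgue_rV_gt0 Vx.
by apply: openI; [exact: cells_open cA i|exact: cells_open cB k].
Qed.

(** Equality of the offsets of [i] and [k] makes the [i]-th piece of [psi] touch [psi] at [x],
    whether or not [x] lies in [B i]. *)
Lemma offset_at i x : A i x -> (\bigcup_k B k) x ->
  psi x = phi x + (b i - c i) /\ subgradient Omega psi x (v i).
Proof.
move=> Ax [k _ Bx]; have Ox := cells_sub cA i x Ax.
have eq_ik : b k - c k = b i - c i by apply: offset_eq; exists x.
have psix : psi x = phi x + (b i - c i).
  have := cells_eq cA i x Ax; have := cells_eq cB k x Bx.
  have := cells_le cA k x Ox; have := cells_le cB i x Ox; lra.
split=> // y Oy; rewrite dotBr psix (cells_eq cA i x Ax).
by have := cells_le cB i y Oy; lra.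
Qed.

Lemma common_subgradient i x : A i x -> (\bigcup_k B k) x ->
  subgradient Omega phi x (v i) /\ subgradient Omega psi x (v i).
Proof.
move=> Ax Bx; split; last by have [] := offset_at i x Ax Bx.
by move=> y Oy; rewrite dotBr (cells_eq cA i x Ax); have := cells_le cA i y Oy; lra.
Qed.

Let N := Omega `\` (\bigcup_i A i `&` \bigcup_i B i).

Let mN : measurable N.
Proof.
by apply: measurableD => //; apply: measurableI; apply: measurable_bigcup_countType => i;
  [exact: cells_measurable cA|exact: cells_measurable cB].
Qed.

Let N0 : lebesgue_rV R d N = 0%E.
Proof.
apply: measure_negligible => //; rewrite /N setDIr; apply: negligibleU.
  apply/negligibleP; last exact: cells_cover cA.
  apply: measurableD => //; apply: measurable_bigcup_countType => i.
  exact: cells_measurable cA.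
apply/negligibleP; last exact: cells_cover cB.
apply: measurableD => //; apply: measurable_bigcup_countType => i.
exact: cells_measurable cB.
Qed.

Let notN x : Omega x -> ~ N x -> exists2 i, A i x & (\bigcup_k B k) x.
Proof.
move=> Ox Nx; have [[i _ Ax] Bx] : (\bigcup_i A i `&` \bigcup_i B i) x.
  by apply: contrapT => h; apply: Nx.
by exists i.
Qed.

(** Join a point of [A i] to one of [A j] by a finely subdivided segment with nodes off the null set
    [N]; [subgradient_chain] bounds the change of [psi - phi] by [t * D]. *)
Lemma offset_const i j : b j - c j <= b i - c i.
Proof.
have [x Ax] := measure_neq0_nonempty _ _ (m_gt0 i) (cells_measure cA i).
have [y Ay] := measure_neq0_nonempty _ _ (m_gt0 j) (cells_measure cA j).
pose D := dot (v j) (y - x) - dot (v i) (y - x).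
apply/ler_addgt0Pr => /= eps eps0.
pose n := Num.truncn (`|D| / eps : R); pose t : R := n.+1%:R^-1.
have t0 : 0 < t by rewrite invr_gt0 ltr0n.
have nt : n.+1%:R * t = 1 by rewrite divff// pnatr_eq0.
have tD : t * D <= eps.
  rewrite mulrC ler_pdivrMr ?ltr0n// mulrC -ler_pdivrMr//.
  apply: le_trans (ltW (truncnS_gt _)).
  by rewrite ler_pM2r ?invr_gt0// ler_norm.
(* A single translation [z] moves all nodes off [N] and keeps the end points in [A i] and [A j]. *)
have [|||z [Az Az'] Nz] := @generic_point R d N
    ([set z | A i (x + z)] `&` [set z | A j (y + z)]) 0
    (fun k => x + ((minn k n.+1)%:R * t) *: (y - x)) (fun=> 1) mN N0.
- by apply: openI; apply: open_translate; [exact: cells_open cA i|exact: cells_open cA j].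
- by split; rewrite /= addr0.
- by move=> _; exact: oner_neq0.
pose p k := x + z + (k%:R * t) *: (y - x).
have pN k : (k <= n.+1)%N -> ~ N (p k).
  move=> kn; have := Nz k; rewrite (minn_idPl kn) scale1r.
  by rewrite /p [x + z + _]addrAC.
have Op k : (k <= n.+1)%N -> Omega (p k).
  move=> kn; rewrite (_ : p k = (k%:R * t) *: (y + z) + (1 - k%:R * t) *: (x + z)).
    move/convex_setP : convexO; apply; last 2 first.
      exact: cells_sub cA j _ Az'.
      exact: cells_sub cA i _ Az.
    apply/andP; split; first by rewrite mulr_ge0// ltW.
    by rewrite -[X in _ <= X]nt ler_pM2r// ler_nat.
  by apply/rowP => l; rewrite !mxE; ring.
have pG k : (k <= n.+1)%N -> exists2 l, A l (p k) & (\bigcup_k B k) (p k).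
  by move=> kn; apply: notN; [exact: Op|exact: pN].
have p0 : p 0%N = x + z by rewrite /p mul0r scale0r addr0.
have p1 : p n.+1 = y + z.
  by rewrite /p nt; apply/rowP => l; rewrite !mxE; ring.
have Bp0 : (\bigcup_k B k) (p 0%N) by have [] := pG 0%N isT.
have Bp1 : (\bigcup_k B k) (p n.+1) by have [] := pG n.+1 (leqnn _).
have Ap0 : A i (p 0%N) by rewrite p0.
have Ap1 : A j (p n.+1) by rewrite p1.
have [phi0 psi0] := common_subgradient i (p 0%N) Ap0 Bp0.
have [phi1 psi1] := common_subgradient j (p n.+1) Ap1 Bp1.
have : (psi (p n.+1) - phi (p n.+1)) - (psi (p 0%N) - phi (p 0%N)) <=
    dot (v j) (t *: (y - x)) - dot (v i) (t *: (y - x)).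
  apply: subgradient_chain psi0 phi0 psi1 phi1.
  by move=> k; rewrite /p -natr1 mulrDl mul1r scalerDl addrA.
  move=> k kn; split; first exact: Op.
  by have [l Al Bl] := pG k kn; exists (v l); exact: common_subgradient.
rewrite (offset_at i _ Ap0 Bp0).1 (offset_at j _ Ap1 Bp1).1 !dotZr -mulrBr -/D.
by move: tD; lra.
Qed.

(** The point [x] itself may lie in [N]; along a generic direction [u] it is approached by points
    off [N], and [convex_le_dense] carries the relation over to [x]. *)
Lemma potentials_le e x : convex_function Omega psi -> Omega x ->
  (forall i, b i - c i = e) -> psi x <= phi x + e.
Proof.
move=> cpsi Ox eqe.
have /nbhs_ballP[r/= r0 xrO] : nbhs x Omega by exact: open_nbhs_nbhs.
(* Index [2n] gives [1/(n+1)] and index [2n+1] gives [-1/(n+1)]. *)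
pose s n : R := (-1) ^+ n * n./2.+1%:R^-1.
have [|||u Ur Nu] := @generic_point R d N (ball 0 r) 0 (fun=> x) s mN N0.
- exact: ball_open.
- exact: ballxx.
- by move=> n; rewrite mulf_neq0 ?signr_eq0// invr_neq0// pnatr_eq0.
have Ou t : `|t| <= 1 -> Omega (x + t *: u).
  move=> t1; apply: xrO; rewrite -ball_normE/= opprD addNKr normrN normrZ.
  move: Ur; rewrite -ball_normE/= sub0r normrN; apply: le_lt_trans.
  by rewrite ler_piMl.
apply: (@convex_le_dense R d Omega phi psi e x u) => // n t tn.
have Oxt : Omega (x + t *: u) by apply: Ou; rewrite tn invf_le1 ?ltr0n// ler1n.
have Nxt : ~ N (x + t *: u).
  have [t0|t0] := leP 0 t.
    have := Nu n.*2; rewrite /s -signr_odd odd_double expr0 mul1r doubleK -tn.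
    by rewrite ger0_norm.
  have := Nu n.*2.+1; rewrite /s -signr_odd/= odd_double/= uphalf_double expr1 -tn.
  by rewrite mulN1r ltr0_norm ?opprK.
have [i Axt Bxt] := notN _ Oxt Nxt; split.
  by rewrite (offset_at i _ Axt Bxt).1 eqe.
by exists (v i); have [] := common_subgradient i _ Axt Bxt.
Qed.

End two_potentials.

Lemma potentials_unique phi psi : convex_with_gradients Omega v m phi ->
  convex_with_gradients Omega v m psi -> exists e, forall x, Omega x -> psi x = phi x + e.
Proof.
move=> gphi gpsi.
have [A [c cA]] := convex_with_gradients_cells phi gphi.
have [B [b cB]] := convex_with_gradients_cells psi gpsi.
have [[i _]|noI] := pselect (exists i : I, True); last first.
  exists 0 => x Ox; have := open_lebesgue_rV_gt0 Omega x openO Ox.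
  rewrite -sum_m (_ : [set: I] = set0) ?esum_set0 ?ltxx//.
  by rewrite -subset0 => i _; apply: noI; exists i.
have eqe j : b j - c j = b i - c i.
  by apply/le_anti; rewrite (offset_const phi A c psi B b)//= (offset_const phi A c psi B b).
have [_ cphi _] := gphi; have [_ cpsi _] := gpsi.
exists (b i - c i) => x Ox; apply/le_anti; apply/andP; split.
  exact: (potentials_le phi A c psi B b).
have : phi x <= psi x + (c i - b i).
  apply: (potentials_le psi B b phi A c) => // j.
  by rewrite -opprB eqe opprB.
by lra.
Qed.

End cells.

(** * Existence *)

Section max_affine.
Context {R : realType} {d : nat} (Omega : set 'rV[R]_d).
Context {I : countType} (v : I -> 'rV[R]_d) (m : I -> R).
Hypotheses (openO : open Omega) (convexO : convex_set Omega).
Hypotheses (boundedO : bounded_set Omega) (injv : injective v).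
Hypothesis (m_gt0 : forall i, 0 < m i).
Hypothesis (sum_m : \esum_(i in [set: I]) (m i)%:E = lebesgue_rV R d Omega).
Implicit Types (h g : I -> R).

Let mO : measurable Omega := open_measurable_rV Omega openO.

Definition cell h i : set 'rV[R]_d :=
  Omega `&` [set x | forall j, dot (v j) x + h j <= dot (v i) x + h i].

Lemma cell_sub h i : cell h i `<=` Omega. Proof. by move=> x []. Qed.

Lemma measurable_cell h i : measurable (cell h i).
Proof.
apply: measurableI => //.
rewrite [X in measurable X](_ : _ =
    ~` \bigcup_(j in [set: I]) [set x | h i - h j < dot (v j - v i) x]).
  apply: measurableC; apply: measurable_bigcup_countType => j.
  by apply: open_measurable_rV; exact: open_dot_gt.
rewrite setC_bigcup; apply/seteqP; split=> x /= hx j.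
  by move=> _ /=; apply/negP; rewrite -leNgt dotBl; have := hx j; lra.
by have /negP := hx j Logic.I; rewrite -leNgt dotBl; lra.
Qed.

Lemma convex_cell h i : convex_set (cell h i).
Proof.
move/convex_setP : convexO => cO; apply/convex_setP => x y t t01 [Ox hx] [Oy hy].
split=> [|j /=]; first exact: cO.
move: t01 => /andP[t0 t1]; have t1' : 0 <= 1 - t by rewrite subr_ge0.
have := ler_wpM2l t0 (hx j); have := ler_wpM2l t1' (hy j).
by rewrite !dotDr !dotZr; lra.
Qed.

(** Membership in the [i]-th cell depends only on the differences [h j - h i]. *)
Lemma cell_mono h g i : (forall j, h j - h i <= g j - g i) ->
  cell g i `<=` cell h i.
Proof.
by move=> hg x [Ox gx]; split=> // j; have := gx j; have := hg j; rewrite /=; lra.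
Qed.

Lemma cell_overlap h i j : i != j -> lebesgue_rV R d (cell h i `&` cell h j) = 0%E.
Proof.
move=> ij; have vij : v i - v j != 0 by rewrite subr_eq0 (inj_eq injv).
apply/eqP; rewrite eq_le measure_ge0 andbT.
rewrite -(lebesgue_rV_hyperplane Omega (v i - v j) (h j - h i) openO convexO boundedO vij).
apply: le_measure; rewrite ?inE.
- by apply: measurableI; exact: measurable_cell.
- by apply: measurableI => //; exact: measurable_dot_eq.
- move=> x [[Ox /(_ j) hj] [_ /(_ i) hi]]; split=> //=; rewrite dotBl.
  by apply/le_anti; apply/andP; split; move: hi hj; lra.
Qed.

Let sum_fin : (\esum_(i in [set: I]) (m i)%:E < +oo)%E.
Proof. by rewrite sum_m; exact: bounded_lebesgue_rV. Qed.

Let m_ge0 i : (0 <= (m i)%:E)%E. Proof. by rewrite lee_fin ltW. Qed.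

Let sum_ge0 (J : set I) : (0 <= \esum_(i in J) (m i)%:E)%E.
Proof. by apply: esum_ge0 => i _. Qed.

Let sum_split i :
  lebesgue_rV R d Omega = ((m i)%:E + \esum_(j in [set~ i]) (m j)%:E)%E.
Proof. by rewrite -sum_m (esumID [set i])// !setTI esum_set1. Qed.

Let rest_fin i : \esum_(j in [set~ i]) (m j)%:E \is a fin_num.
Proof.
by rewrite ge0_fin_numE//; apply: le_lt_trans sum_fin; rewrite sum_m (sum_split i) leeDr.
Qed.

(** * The Perron family relative to a fixed index *)

Context (i0 : I) (r : R).
Hypotheses (r_gt0 : 0 < r) (Omega_r : forall x, Omega x -> forall k, `|x ord0 k| < r).

(** A bound for [dot (v j - v i0)] on [Omega]: sum norm of the vector times a bound for the maximum
    norm of the points. *)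
Definition spread j : R := (\sum_(k < d) `|(v j - v i0) ord0 k|) * r.

(* At height [base j] the [j]-th affine function lies below the [i0]-th one on
   all of [Omega], so that its cell is empty. *)
Definition base j : R := - spread j - 1.

Lemma spread_ge0 j : 0 <= spread j.
Proof. by rewrite mulr_ge0 ?(ltW r_gt0)// sumr_ge0. Qed.

Lemma spread_i0 : spread i0 = 0.
Proof. by rewrite /spread subrr big1 ?mul0r// => k _; rewrite mxE normr0. Qed.

Lemma spreadP j x : Omega x -> `|dot (v j) x - dot (v i0) x| <= spread j.
Proof.
by move=> Ox; rewrite -dotBl; apply: dot_le_norm => k; rewrite ltW// Omega_r.
Qed.

Lemma spread_le j x : Omega x -> dot (v j) x - dot (v i0) x <= spread j.
Proof. by move=> /(spreadP j); rewrite ler_norml => /andP[]. Qed.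

Lemma spread_ge j x : Omega x -> - spread j <= dot (v j) x - dot (v i0) x.
Proof. by move=> /(spreadP j); rewrite ler_norml => /andP[]. Qed.

Record admissible h : Prop := {
  adm_i0 : h i0 = 0;
  adm_base : forall j, base j <= h j;
  adm_finite : finite_set [set j | h j != base j];
  adm_measure : forall i, i != i0 -> (lebesgue_rV R d (cell h i) <= (m i)%:E)%E }.
Arguments adm_i0 {h}.
Arguments adm_base {h}.
Arguments adm_finite {h}.
Arguments adm_measure {h}.

Lemma base_i0 : base i0 = -1.
Proof. by rewrite /base spread_i0; lra. Qed.

Lemma exists_max_seq (s : seq I) (f : I -> R) j : j \in s ->
  exists2 i, i \in s & forall k, k \in s -> f k <= f i.
Proof.
elim: s j => // a [|b s] IH j _.
  by exists a; [exact: mem_head|move=> k; rewrite inE => /eqP ->].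
have [i si imax] := IH b (mem_head _ _).
have [ai|/ltW ia] := leP (f a) (f i).
  exists i; first by rewrite inE si orbT.
  by move=> k; rewrite inE => /predU1P[->//|/imax].
exists a; first exact: mem_head.
by move=> k; rewrite inE => /predU1P[->//|/imax /le_trans]; apply.
Qed.

Lemma cell_cover h x : admissible h -> Omega x -> exists i, cell h i x.
Proof.
move=> hh Ox; have /finite_seqP[s sE] := adm_finite hh.
(* The finite set of heights off [base] contains [i0], as [h i0 = 0] and [base i0 = -1]; all
   functions at [base] lie below the [i0]-th. *)
have i0s : i0 \in s.
  suff : [set` s] i0 by [].
  by rewrite -sE /= (adm_i0 hh) base_i0 eq_sym oppr_eq0 oner_neq0.
have [i si imax] := exists_max_seq s (fun j => dot (v j) x + h j) i0 i0s.
exists i; split=> // j /=.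
have [js|js] := boolP (j \in s); first exact: imax.
apply: le_trans (imax _ i0s); rewrite (adm_i0 hh).
have -> : h j = base j.
  apply/eqP/negPn/negP => hj; have : [set` s] j by rewrite -sE.
  by rewrite /= (negbTE js).
by have := spread_le j x Ox; rewrite /base; lra.
Qed.

(** The cells cover [Omega], and the others take at most their shares [m i]. *)
Lemma adm_measure_i0 h : admissible h -> ((m i0)%:E <= lebesgue_rV R d (cell h i0))%E.
Proof.
move=> hh; rewrite -(leeD2rE _ _ (rest_fin i0)) -sum_split.
have := measure_le_esum (lebesgue_rV R d) [set: I] (cell h) Omega.
move=> /(_ (measurable_cell h) mO)/(_ _)/wrap[x Ox|].
  by have [i hi] := cell_cover h x hh Ox; exists i.
move/le_trans; apply; rewrite (esumID [set i0])// !setTI esum_set1//.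
by rewrite leeD2l//; apply: le_esum => i /eqP; exact: adm_measure.
Qed.

(** The [i0]-th cell has positive volume, hence a point; there the [j]-th function does not exceed
    the [i0]-th. *)
Lemma adm_le h j : admissible h -> h j <= spread j.
Proof.
move=> hh; have [x [Ox hx]] : cell h i0 !=set0.
  apply/set0P/negP => /eqP h0; have := adm_measure_i0 h hh.
  by rewrite h0 measure0 lee_fin leNgt m_gt0.
by have := hx j; have := spread_ge j x Ox; rewrite /= (adm_i0 hh); lra.
Qed.

(** The maximum keeps the larger of the two [i]-th heights and never lowers the others, so its
    [i]-th cell lies in that of [h] or of [g]. *)
Lemma adm_max h g : admissible h -> admissible g ->
  admissible (fun j => Num.max (h j) (g j)).
Proof.
move=> hh gg; split.
- by rewrite (adm_i0 hh) (adm_i0 gg) maxxx.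
- by move=> j; rewrite le_max (adm_base hh).
- apply: (@sub_finite_set _ _ ([set j | h j != base j] `|` [set j | g j != base j])).
    by move=> j /=; have [_|_] := leP (h j) (g j); [right|left].
  by rewrite finite_setU; split; [exact: adm_finite|exact: adm_finite].
- move=> i ii0; have [hg|gh] := leP (h i) (g i).
    apply: le_trans (adm_measure gg i ii0); apply: le_measure; rewrite ?inE.
    + exact: measurable_cell.
    + exact: measurable_cell.
    + apply: cell_mono => j; rewrite (max_idPr hg) lerD2r.
      by rewrite le_max lexx orbT.
  apply: le_trans (adm_measure hh i ii0); apply: le_measure; rewrite ?inE.
  + exact: measurable_cell.
  + exact: measurable_cell.
  + apply: cell_mono => j; rewrite (max_idPl (ltW gh)) lerD2r.
    by rewrite le_max lexx.
Qed.

Lemma adm_base_max : admissible (fun j => if j == i0 then 0 else base j).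
Proof.
split; first by rewrite eqxx.
- by move=> j; case: eqP => // ->; rewrite base_i0; lra.
- apply: (@sub_finite_set _ _ [set i0]); last exact: finite_set1.
  by move=> j /=; case: (eqVneq j i0) => [->|_]; rewrite ?eqxx.
- move=> i /negbTE ii0; rewrite (_ : cell _ i = set0) ?measure0 ?lee_fin ?ltW//.
  rewrite -subset0 => x [Ox /(_ i0)] /=; rewrite eqxx ii0 /base.
  by have := spread_le i x Ox; lra.
Qed.

Definition hsup j : R := sup [set h j | h in admissible].

Lemma has_sup_adm j : has_sup [set h j | h in admissible].
Proof.
split; first by eexists; exists (fun j => if j == i0 then 0 else base j);
  [exact: adm_base_max|by []].
by exists (spread j) => _ [h hh <-]; exact: adm_le.
Qed.

Lemma hsup_ge h j : admissible h -> h j <= hsup j.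
Proof. by move=> hh; apply: ub_le_sup; [case: (has_sup_adm j)|exists h]. Qed.

Lemma hsup_i0 : hsup i0 = 0.
Proof.
apply/le_anti/andP; split; last first.
  by have := hsup_ge _ i0 adm_base_max; rewrite eqxx.
by apply: ge_sup => [|_ [h hh <-]]; [case: (has_sup_adm i0)|rewrite (adm_i0 hh)].
Qed.

(** One increasing sequence serves all indices: enumerate approximants for all pairs of an index and
    a precision, and take running maxima. *)
Lemma adm_approx : exists H : nat -> I -> R, [/\ forall n, admissible (H n),
  forall j, {homo H^~ j : n p / (n <= p)%N >-> n <= p} &
  forall j (eps : R), 0 < eps -> exists n, hsup j - eps < H n j].
Proof.
have /choice[g gP] (jk : I * nat) :
    exists h, admissible h /\ hsup jk.1 - jk.2.+1%:R^-1 < h jk.1.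
  have k0 : 0 < jk.2.+1%:R^-1 :> R by rewrite invr_gt0 ltr0n.
  by have [_ [h hh <-]] := sup_adherent k0 (has_sup_adm jk.1); exists h.
pose G n := oapp g (fun j => if j == i0 then 0 else base j) (pickle_inv n).
have admG n : admissible (G n).
  by rewrite /G; case: pickle_inv => [jk|]; [exact: (gP jk).1|exact: adm_base_max].
pose H := fix H n : I -> R :=
  if n is k.+1 then fun j => Num.max (H k j) (G n j) else G 0%N.
have HG n j : G n j <= H n j by case: n => [//|n]; rewrite /= le_max lexx orbT.
exists H; split.
- by elim=> [|n IH]; [exact: admG|exact: adm_max].
- move=> j; apply: homo_leq => [//|x y z|n]; first exact: le_trans.
  by rewrite /= le_max lexx.
- move=> j eps eps0; pose k := Num.truncn (eps^-1).
  exists (pickle (j, k)); apply: lt_le_trans (HG _ _).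
  rewrite /G pickleK_inv /=; apply: le_lt_trans (gP (j, k)).2 => /=.
  rewrite lerD2l lerN2 -[leRHS]invrK lef_pV2 ?posrE ?invr_gt0 ?ltr0n//.
  exact/ltW/truncnS_gt.
Qed.

(** Raise the [i]-th height of [H n] to [hsup i + q n]. Were the cell [C n] smaller than [m i], the
    result would be admissible, against the supremum. The [C n] decrease into [cell hsup i], and
    measure is continuous from above. *)
Lemma cell_hsup_ge i : ((m i)%:E <= lebesgue_rV R d (cell hsup i))%E.
Proof.
have [H [admH Hmono Hsup]] := adm_approx.
have [q qE] : exists q : nat -> R, forall n, q n = n.+1%:R^-1 by eexists.
pose raise n j := if j == i then hsup i + q n else H n j.
have n0 n : 0 < q n by rewrite qE invr_gt0 ltr0n.
have raise_le n j : H n j <= raise n j.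
  rewrite /raise; case: eqP => // ->.
  by have := hsup_ge (H n) i (admH n); have := n0 n; lra.
pose C n := cell (raise n) i.
have mC n : measurable (C n) by exact: measurable_cell.
have C_ge n : ((m i)%:E <= lebesgue_rV R d (C n))%E.
  (* Raising at [i0] breaks the normalisation [h i0 = 0], but it enlarges a cell already known to be
     large enough. *)
  have [ii0|ii0] := eqVneq i i0.
    rewrite ii0; apply: le_trans (adm_measure_i0 (H n) (admH n)) _.
    apply: le_measure; rewrite ?inE//; first exact: measurable_cell.
    rewrite /C ii0; apply: cell_mono => j; rewrite (adm_i0 (admH n)) /raise ii0 eqxx.
    case: eqP => [->|_]; first by rewrite (adm_i0 (admH n)) !subrr.
    by rewrite hsup_i0; have := n0 n; lra.
  rewrite leNgt; apply/negP => lt_C.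
  have adm_raise : admissible (raise n).
    split.
    - by rewrite /raise eq_sym (negbTE ii0) (adm_i0 (admH n)).
    - by move=> j; apply: le_trans (raise_le n j); exact: adm_base.
    - apply: (@sub_finite_set _ _ ([set j | H n j != base j] `|` [set i])).
        by move=> j; rewrite /= /raise; case: (eqVneq j i) => [->|_] ?; [right|left].
      by rewrite finite_setU; split; [exact: adm_finite|exact: finite_set1].
    - move=> j ji0; have [->|ji] := eqVneq j i; first exact: ltW.
      apply: le_trans (adm_measure (admH n) j ji0).
      apply: le_measure; rewrite ?inE//; [exact: measurable_cell|exact: measurable_cell|].
      apply: cell_mono => k; have := raise_le n k.
      by rewrite {3}/raise (negbTE ji); lra.
  have := hsup_ge (raise n) i adm_raise.
  by rewrite /raise eqxx leNgt ltrDl n0.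
have C_mono : {homo C : n p / (n <= p)%N >-> (p <= n)%O}.
  move=> n p np; apply/subsetPset; apply: cell_mono => j; rewrite /raise eqxx.
  case: eqP => [_|_]; first by rewrite !subrr.
  have : q p <= q n by rewrite !qE lef_pV2 ?posrE ?ltr0n// ler_nat.
  by have := Hmono j n p np; lra.
have mCC : measurable (\bigcap_n C n) by exact: bigcap_measurable.
have C_sub : \bigcap_n C n `<=` cell hsup i.
  move=> x Cx; have [Ox _] := Cx 0%N Logic.I; split=> // j /=.
  have [->|ji] := eqVneq j i; first exact: lexx.
  apply/ler_addgt0Pr => /= eps eps0; have eps2 : 0 < eps / 2 by rewrite divr_gt0.
  have [n Hn] := Hsup j (eps / 2) eps2.
  pose k := Num.truncn ((eps / 2)^-1).
  have kP : q (maxn n k) <= eps / 2.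
    rewrite qE -[leRHS]invrK lef_pV2 ?posrE ?invr_gt0 ?ltr0n//.
    by apply: le_trans (ltW (truncnS_gt _)) _; rewrite ler_nat ltnS leq_maxr.
  have [_ /(_ j)] := Cx (maxn n k) Logic.I.
  rewrite /raise eqxx (negbTE ji); have := Hmono j n (maxn n k) (leq_maxl _ _).
  by move: Hn kP; lra.
apply: (@le_trans _ _ (lebesgue_rV R d (\bigcap_n C n))); last first.
  by apply: le_measure; rewrite ?inE//; exact: measurable_cell.
have : (lebesgue_rV R d \o C) x @[x --> \oo] --> lebesgue_rV R d (\bigcap_n C n).
  apply: nonincreasing_cvg_mu => //.
  apply: le_lt_trans (bounded_lebesgue_rV Omega boundedO mO).
  by apply: le_measure; rewrite ?inE//; exact: cell_sub.
by move/cvge_to_ge; apply; near=> n; exact: C_ge.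
Unshelve. all: by end_near. Qed.

(** The overlap of two interiors is open and null, hence empty. *)
Lemma cell_interior_disjoint h : trivIset setT (fun i => (cell h i)°).
Proof.
move=> i j _ _ [x [ix jx]]; apply/eqP/negPn/negP => ij.
have oI : open ((cell h i)° `&` (cell h j)°) by apply: openI; exact: open_interior.
have : (lebesgue_rV R d ((cell h i)° `&` (cell h j)°) <= 0)%E.
  rewrite -(cell_overlap h i j ij); apply: le_measure; rewrite ?inE.
  - exact: open_measurable_rV.
  - by apply: measurableI; exact: measurable_cell.
  - by move=> y [/interior_subset ? /interior_subset ?]; split.
by rewrite leNgt (open_lebesgue_rV_gt0 _ x).
Qed.

Lemma measure_cell_interior h i :
  lebesgue_rV R d (cell h i)° = lebesgue_rV R d (cell h i).
Proof.
apply: (lebesgue_rV_convex_interior Omega) => //.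
- exact: convex_cell.
- exact: measurable_cell.
- exact: cell_sub.
Qed.

Lemma cell_hsup_measure i : lebesgue_rV R d (cell hsup i)° = (m i)%:E.
Proof.
have mI j : measurable (cell hsup j)° by apply: open_measurable_rV; exact: open_interior.
apply/le_anti/andP; split; last by rewrite measure_cell_interior; exact: cell_hsup_ge.
rewrite -(leeD2rE _ _ (rest_fin i)) -sum_split.
apply: (@le_trans _ _ (lebesgue_rV R d (\bigcup_j (cell hsup j)°))); last first.
  apply: le_measure; rewrite ?inE//; first exact: measurable_bigcup_countType.
  by move=> x [j _ /interior_subset /cell_sub].
rewrite (measure_bigcup_esum (lebesgue_rV R d))//; last exact: cell_interior_disjoint.
rewrite [leRHS](esumID [set i])// !setTI esum_set1// leeD2l//.
by apply: le_esum => j _; rewrite [leRHS]measure_cell_interior; exact: cell_hsup_ge.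
Qed.

(* If the [i]-th function is maximal at [x] and exceeds the [i0]-th one by [M],
   it still does so on the orthant cube [Q] at [x] on which
   [dot (v i - v i0)] is larger than at [x]. Only indices [j] with
   [M <= 2 * spread j] can be maximal on [Q], and for large [M] their cells are too
   small to cover it. *)
Lemma hsup_bounded x : Omega x ->
  exists M, forall j, dot (v j) x + hsup j <= dot (v i0) x + M.
Proof.
move=> Ox; have /nbhs_ballP[rho/= rho0 xO] : nbhs x Omega by exact: open_nbhs_nbhs.
have rhod : 0 < rho ^+ d by rewrite exprn_gt0.
(* Cells with index outside [F], other than the [i0]-th, have total volume below [rho ^+ d], the
   volume of [Q]. *)
have [F finF Ftail] := esum_tail m _ (fun i => ltW (m_gt0 i)) sum_fin rhod.
have [s sF] := (finite_seqP F).1 finF.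
pose M := \sum_(j <- s) (2 * spread j) + 1.
have sp2 j : 0 <= 2 * spread j by rewrite mulr_ge0// spread_ge0.
have sM j : F j -> 2 * spread j < M.
  rewrite sF /= /M => js; rewrite (big_rem j js)/= -addrA ltrDl ltr_wpDl//.
  exact: sumr_ge0.
have M0 : 0 < M by rewrite ltr_wpDl// sumr_ge0.
exists M => j; rewrite -lerBrDl; apply: ge_sup => [|_ [h hh <-]].
  by case: (has_sup_adm j).
rewrite leNgt; apply/negP => gap_j.
have [i [_ hi]] := cell_cover h x hh Ox.
have gap_i : dot (v i0) x + M < dot (v i) x + h i by have := hi j; rewrite /=; lra.
pose w := v i - v i0.
pose a : 'rV[R]_d := \row_k (if 0 <= w ord0 k then x ord0 k else x ord0 k - rho).
pose Q := box a (\row_k (a ord0 k + rho)).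
have QP y : Q y -> Omega y /\ dot w x <= dot w y.
  move=> Qy; split.
    apply: xO; rewrite ball_rVE// => k; have := Qy k; rewrite !mxE.
    by case: ifP => _ /andP[? ?]; apply/andP; split; lra.
  apply: ler_sum => k _; have := Qy k; rewrite !mxE.
  have [wk|wk] := leP 0 (v i ord0 k - v i0 ord0 k) => /andP[yk yk'].
    by apply: ler_wpM2l => //; exact: ltW.
  by rewrite ler_wnM2l ?(ltW wk)//; lra.
have QF : Q `<=` \bigcup_(k in ~` F `&` [set~ i0]) cell h k.
  move=> y Qy; have [Oy wxy] := QP y Qy.
  have [k hk] := cell_cover h y hh Oy; exists k => //.
  (* The gap [M] is made up by [h k] and by the difference between [v k] and [v i0] at [y], each at
     most [spread k]. *)
  have leM : M <= 2 * spread k.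
    move: wxy; rewrite /w !dotBl => wxy.
    have := hk.2 i; have := adm_le h k hh; have := spread_le k y Oy.
    by rewrite /=; lra.
  split=> [/sM|/= ki0]; first by rewrite ltNge leM.
  by move: leM; rewrite ki0 spread_i0 mulr0 leNgt M0.
have : ((rho ^+ d)%:E <=
    \esum_(k in ~` F `&` [set~ i0]) lebesgue_rV R d (cell h k))%E.
  rewrite -(lebesgue_rV_cube a rho (ltW rho0)).
  apply: measure_le_esum QF; [exact: measurable_cell|exact: measurable_box].
apply/negP; rewrite -ltNge.
apply: le_lt_trans Ftail; rewrite [leRHS](esumID [set~ i0])//.
apply: le_trans (leeDl _ (sum_ge0 _)).
by apply: le_esum => k [_ /eqP]; exact: adm_measure.
Qed.

(** Outside [Omega] the set may be unbounded and [sup] a default value; this does not affect the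
    behaviour on the open set [Omega]. *)
Definition potential (x : 'rV[R]_d) : R^o :=
  sup [set dot (v j) x + hsup j | j in [set: I]].

Lemma potential_ge j x : Omega x -> dot (v j) x + hsup j <= potential x.
Proof.
move=> Ox; apply: ub_le_sup; last by exists j.
by have [M hM] := hsup_bounded x Ox; exists (dot (v i0) x + M) => _ [k _ <-].
Qed.

Lemma potential_le x (c : R) : (forall j, dot (v j) x + hsup j <= c) -> potential x <= c.
Proof.
by move=> xc; apply: ge_sup => [|_ [j _ <-]//]; exists (dot (v i0) x + hsup i0), i0.
Qed.

Lemma potential_cell i x : cell hsup i x -> potential x = dot (v i) x + hsup i.
Proof.
by move=> [Ox hx]; apply/le_anti; rewrite potential_ge// andbT; exact: potential_le.
Qed.

Lemma potential_convex : convex_function Omega potential.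
Proof.
apply/convex_functionP => x y t /andP[t0 t1] Ox Oy; apply: potential_le => j.
have t1' : 0 <= 1 - t by rewrite subr_ge0.
have := ler_wpM2l t0 (potential_ge j x Ox).
have := ler_wpM2l t1' (potential_ge j y Oy).
by rewrite dotDr !dotZr; lra.
Qed.

Lemma potential_near i x : (cell hsup i)° x ->
  \forall y \near x, potential y = dot (v i) y + hsup i.
Proof. by apply: filterS => y; exact: potential_cell. Qed.

Lemma potential_with_gradients : convex_with_gradients Omega v m potential.
Proof.
have cells : affine_cells Omega v m potential (fun i => (cell hsup i)°) hsup.
  split.
  - by move=> i; exact: open_interior.
  - by move=> i x /interior_subset[].
  - exact: cell_hsup_measure.
  - exact: cell_interior_disjoint.
  - by move=> i x /interior_subset; exact: potential_cell.
  - by move=> i y; exact: potential_ge.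
split; last first.
- move=> i; exists (cell hsup i)°; split.
  + exact: open_interior.
  + by apply: convex_set_interior; exact: convex_cell.
  + by move=> x /interior_subset[].
  + exact: cell_hsup_measure.
  + by move=> x ix; exact/near_affine_gradient/potential_near.
- exact: potential_convex.
(* The interiors of the cells cover [Omega] up to a null set, and [potential] is affine near each of
   their points. *)
- have := cells_cover Omega v m openO boundedO sum_m potential _ _ cells.
  move=> cover0; have mN : measurable (Omega `\` \bigcup_i (cell hsup i)°).
    apply: measurableD => //; apply: measurable_bigcup_countType => i.
    by apply: open_measurable_rV; exact: open_interior.
  apply: (@negligibleS _ _ _ _ (Omega `\` \bigcup_i (cell hsup i)°)); last first.
    exact/negligibleP.
  move=> x /= nx; split; first by apply: contrapT => nOx; apply: nx.
  move=> [i _ ix]; apply: nx => _; exists (dot (v i)), (hsup i).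
  exact: potential_near.
Qed.

End max_affine.

Theorem theorem1p1 (R : realType) (d : nat) (Omega : set 'rV[R]_d)
  (I : countType) (v : I -> 'rV[R]_d) (m : I -> R) :
  open Omega -> convex_set Omega -> bounded_set Omega ->
  injective v -> (forall i, 0 < m i) ->
  \esum_(i in [set: I]) (m i)%:E = lebesgue_rV R d Omega ->
  exists phi : 'rV[R]_d -> R^o,
    convex_with_gradients Omega v m phi /\
    forall psi : 'rV[R]_d -> R^o, convex_with_gradients Omega v m psi ->
      exists c : R, forall x, Omega x -> psi x = phi x + c.
Proof.
move=> openO convexO boundedO injv m_gt0 sum_m.
suff [phi gphi] : exists phi, convex_with_gradients Omega v m phi.
  exists phi; split=> // psi gpsi.
  exact: (potentials_unique Omega v m).
(* The construction starts from an index [i0]; with an empty family [Omega] is open of volume zero,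
   hence empty. *)
have [[i0 _]|noI] := pselect (exists i : I, True).
  have [r r0 Or] := bounded_rVP Omega boundedO.
  exists (potential Omega v m i0 r).
  exact: potential_with_gradients.
have O0 : Omega = set0.
  rewrite -subset0 => x Ox; have := open_lebesgue_rV_gt0 Omega x openO Ox.
  rewrite -sum_m (_ : [set: I] = set0) ?esum_set0 ?ltxx//.
  by rewrite -subset0 => i _; apply: noI; exists i.
exists (fun=> 0); split.
- rewrite /locally_affine_ae O0; apply/aeW => x [].
- by rewrite O0; apply/convex_functionP => x y t _ [].
- by move=> i; case: noI; exists i.
Qed.
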